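(* Let $T>0$ and let $\zeta:]-T,T[\rightarrow\mathbb{H}$ be a smooth horizontal curve parametrized by arc length in the Heisenberg group $\mathbb{H}$, with geodesic curvature $k_\zeta$. Then, as $t\to 0$, $$d_{\mathbb{H}}^2(\zeta(0),\zeta(t))=t^2-\frac{\left(k_{\zeta}(0)\right)^2}{720}\,t^6+\mathcal{O}(t^7).$$
   Context: The Heisenberg group $\mathbb{H}$ is $\mathbb{R}^3$ with coordinates $(x,y,z)$, endowed with the two-dimensional distribution spanned by $X_1=\frac{\partial}{\partial x}-\frac{y}{2}\frac{\partial}{\partial z}$ and $X_2=\frac{\partial}{\partial y}+\frac{x}{2}\frac{\partial}{\partial z}$, with the metric on the distribution for which $(X_1,X_2)$ is an orthonormal frame. A horizontal curve is a Lipschitz curve that is almost everywhere tangent to the distribution, whose velocity components with respect to $(X_1,X_2)$ are measurable and essentially bounded; its length is the integral of the norm of its velocity (norm with respect to the orthonormal frame $(X_1,X_2)$). The distance $d_{\mathbb{H}}(A,B)$ is the infimum of the lengths of horizontal curves joining $A$ to $B$. A smooth ($\mathcal{C}^\infty$) curve is horizontal if and only if it is everywhere tangent to the distribution, and it is parametrized by arc length if its velocity has norm $1$ everywhere. For a smooth horizontal curve $\zeta(t)=(x(t),y(t),z(t))$ parametrized by arc length, the characteristic deviation is $h_\zeta(t)=\dot x(t)\ddot y(t)-\dot y(t)\ddot x(t)$, and the geodesic curvature is $k_\zeta(t)=\dot h_\zeta(t)$. (Equivalently, writing $\zeta'(t)=\cos(\theta(t))X_1+\sin(\theta(t))X_2$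 with $\theta$ smooth, $h_\zeta=\dot\theta$ and $k_\zeta=\ddot\theta$.) *)

(* Defs.v *)
From mathcomp Require Import all_boot all_order all_algebra.
From mathcomp Require Import all_classical all_reals all_analysis.

Set Implicit Arguments.
Unset Strict Implicit.
Unset Printing Implicit Defensive.

Import Order.TTheory GRing.Theory Num.Theory.
Import numFieldNormedType.Exports.

Local Open Scope classical_set_scope.
Local Open Scope ring_scope.

(* Both the points and the tangent vectors of the Heisenberg group, in the
   coordinates (x, y, z). *)
Notation heis R := (R * R * R)%type.

Section Heisenberg.
Context {R : realType}.

Local Notation mu := (@lebesgue_measure R).

Definition xc (p : heis R) : R := p.1.1.
Definition yc (p : heis R) : R := p.1.2.

Definition X1 (p : heis R) : heis R := (1, 0, - (yc p / 2)).
Definition X2 (p : heis R) : heis R := (0, 1, xc p / 2).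

(* The horizontal vector at p with components u in the frame (X1, X2), and its
   norm for the metric that makes this frame orthonormal. *)
Definition hvec (p : heis R) (u : R * R) : heis R := u.1 *: X1 p + u.2 *: X2 p.

Definition hnorm (u : R * R) : R := Num.sqrt (u.1 ^+ 2 + u.2 ^+ 2).

(* u is the velocity of gamma; gamma determines it only almost everywhere, so
   asking that it be Borel measurable, rather than Lebesgue measurable, is no
   restriction on gamma. *)
Definition horizontal_curve (a b : R) (gamma : R -> heis R)
    (u : R -> R * R) : Prop :=
  [/\ [lipschitz gamma t | t in `[a, b]],
      measurable_fun `[a, b] (fun t => (u t).1),
      measurable_fun `[a, b] (fun t => (u t).2),
      exists M : R, {ae mu, forall t, t \in `[a, b] ->
        `|(u t).1| <= M /\ `|(u t).2| <= M}
    & {ae mu, forall t, t \in `[a, b] ->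
        is_derive t 1 gamma (hvec (gamma t) (u t))}].

Definition hlength (a b : R) (u : R -> R * R) : \bar R :=
  (\int[mu]_(t in `[a, b]) (hnorm (u t))%:E)%E.

Definition heis_dist (A B : heis R) : \bar R :=
  ereal_inf [set l : \bar R |
    exists (a b : R) (gamma : R -> heis R) (u : R -> R * R),
      [/\ a <= b, horizontal_curve a b gamma u, gamma a = A, gamma b = B
        & l = hlength a b u]].

(* Meant for U open: the derivatives are then those of the restriction of zeta
   to U. *)
Definition smooth_on (U : set R) (zeta : R -> heis R) : Prop :=
  forall (n : nat) (t : R), U t -> derivable (derive1n n zeta) t 1.

Definition horizontal_on (U : set R) (zeta : R -> heis R) : Prop :=
  forall t, U t -> exists u : R * R, derive1 zeta t = hvec (zeta t) u.

Definition arclength_on (U : set R) (zeta : R -> heis R) : Prop :=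
  forall (t : R) (u : R * R), U t ->
    derive1 zeta t = hvec (zeta t) u -> hnorm u = 1.

Definition char_deviation (zeta : R -> heis R) (t : R) : R :=
  let x := xc \o zeta in let y := yc \o zeta in
  derive1 x t * derive1n 2 y t - derive1 y t * derive1n 2 x t.

Definition geodesic_curvature (zeta : R -> heis R) : R -> R :=
  derive1 (char_deviation zeta).

End Heisenberg.

(* Main.v *)
(* By left translation we look at a curve from the origin with end point
   (q, z), |q|^2 = c. Among curves of given length a circle arc encloses the
   largest area, and d^2 is the maximum over lam of
     2 lam z + c (lam/2) cot (lam/2).
   The bound from below, for one lam, is a calibration: completing squares
   gives a function whose growth along any horizontal curve is controlled by
   the length; we use a polynomial approximation of the tangent which is a
   supersolution of the Riccati equation, so that no trigonometry is needed.
   The bound from above is the energy of an explicit polynomial curve which has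
   exactly the required chord and area.
   With h and k the characteristic deviation and the geodesic curvature at 0,
   both bounds agree with t^2 - k^2 t^6/720 up to O(t^7) when lam is taken to be
   h t + k t^2/2: the lower bound is nearly maximal there, so that an error
   O(t^3) on lam changes it only by O(t^8). The Taylor coefficients of c and z follow from differentiating
   x'^2 + y'^2 = 1 four times. *)
Require Import Defs.
From mathcomp Require Import all_boot all_order all_algebra.
From mathcomp Require Import all_classical all_reals all_analysis.
From mathcomp Require Import measurable_realfun ring lra.

Import Order.TTheory GRing.Theory Num.Theory.
Import numFieldNormedType.Exports.

Local Open Scope classical_set_scope.
Local Open Scope ring_scope.

(** * Derivation rules for functions given by explicit expressions in a bound variable *)

Section derivation_rules.
Context {R : realType}.
Implicit Types (f g : R -> R) (x a b : R).

Lemma is_deriveD_fun f g x a b : is_derive x 1 f a -> is_derive x 1 g b ->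
  is_derive x 1 (fun t => f t + g t) (a + b).
Proof. by move=> fa gb; exact: is_deriveD. Qed.

Lemma is_deriveB_fun f g x a b : is_derive x 1 f a -> is_derive x 1 g b ->
  is_derive x 1 (fun t => f t - g t) (a - b).
Proof. by move=> fa gb; exact: is_deriveB. Qed.

Lemma is_deriveM_fun f g x a b : is_derive x 1 f a -> is_derive x 1 g b ->
  is_derive x 1 (fun t => f t * g t) (a * g x + f x * b).
Proof.
move=> fa gb; apply: (@is_derive_eq _ _ _ (f * g)).
by rewrite /GRing.scale/= addrC [g x * _]mulrC.
Qed.

Lemma is_derive_comp_fun f g x a b : is_derive x 1 f a ->
  is_derive (f x) 1 g b -> is_derive x 1 (fun t => g (f t)) (b * a).
Proof. by move=> fa gb; apply: is_derive1_comp. Qed.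

Lemma is_derive_cst_fun (c : R) x : is_derive x 1 (fun=> c) 0.
Proof. exact: is_derive_cst. Qed.

End derivation_rules.

(** * Monotonicity of Lipschitz functions whose derivative is almost everywhere nonpositive *)

Section lipschitz_monotone.
Context {R : realType}.
Local Notation mu := (@lebesgue_measure R).

Lemma ae_imp (P Q : R -> Prop) : (forall t, P t -> Q t) ->
  {ae mu, forall t, P t} -> {ae mu, forall t, Q t}.
Proof. by move=> PQ; have F := ae_filter_ringOfSetsType mu; exact: filterS PQ. Qed.

Lemma ae_imp2 (P P' Q : R -> Prop) : (forall t, P t -> P' t -> Q t) ->
  {ae mu, forall t, P t} -> {ae mu, forall t, P' t} -> {ae mu, forall t, Q t}.
Proof. by move=> PQ; have F := ae_filter_ringOfSetsType mu; exact: filterS2 PQ. Qed.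

Lemma MVT_bounds (F f : R -> R) (x y A B : R) : x <= y ->
  (forall t, x <= t <= y -> is_derive t 1 F (f t)) ->
  (forall t, x <= t <= y -> A <= f t <= B) ->
  A * (y - x) <= F y - F x <= B * (y - x).
Proof.
move=> xy dF fAB.
have [c /[!in_itv]/= cxy ->] : exists2 c, c \in `[x, y] & F y - F x = f c * (y - x).
  apply: MVT_segment => // [t txy|].
    by apply: dF; move: txy; rewrite in_itv/= => /andP[/ltW -> /ltW ->].
  apply: derivable_within_continuous => t txy.
  by apply: ex_derive; apply: dF; rewrite in_itv/= in txy.
by have /andP[Af fB] := fAB _ cxy; rewrite !ler_wpM2r// subr_ge0.
Qed.

Lemma is_derive_continuous (f : R -> R) (t d : R) :
  is_derive t 1 f d -> {for t, continuous f}.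
Proof.
by move=> fd; apply/differentiable_continuous/derivable1_diffP; exact: ex_derive.
Qed.

Lemma integral_is_derive (F f : R -> R) (a b : R) : a < b ->
  (forall t, t \in `[a, b] -> is_derive t 1 F (f t)) -> continuous f ->
  (\int[mu]_(t in `[a, b]) (f t)%:E = (F b - F a)%:E)%E.
Proof.
move=> ab dF cf; rewrite EFinB; apply: continuous_FTC2 => //.
- exact: continuous_subspaceT.
- split=> [t tab||].
  + by apply: ex_derive; apply: dF; exact: subset_itv_oo_cc tab.
  + apply: cvg_at_right_filter; apply: is_derive_continuous (dF _ _).
    by rewrite in_itv/= lexx ltW.
  + apply: cvg_at_left_filter; apply: is_derive_continuous (dF _ _).
    by rewrite in_itv/= lexx ltW.
- move=> t tab; rewrite derive1E; apply: derive_val.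
  exact/dF/subset_itv_oo_cc.
Qed.

Lemma klipschitz_continuous (G : R -> R) (K : R) : 0 <= K ->
  (forall s t, `|G s - G t| <= K * `|s - t|) -> continuous G.
Proof.
move=> K0 GL.
move=> t; apply/(@cvgrPdist_le _ R^o) => e e0.
near=> s; rewrite (le_trans (GL _ _))//.
have : `|t - s| <= e / (K + 1).
  by near: s; apply: cvgr_dist_le; [exact: cvg_id|rewrite divr_gt0// ltr_wpDl].
rewrite ler_pdivlMr ?ltr_wpDl// => h; apply: le_trans h.
by rewrite mulrC ler_wpM2l// lerDl.
Unshelve. all: by end_near. Qed.

Lemma continuous_diff_quotient (G : R -> R) (h : R) : continuous G ->
  continuous (fun t => h^-1 * (G (t + h) - G t)).
Proof.
move=> cG t; apply: cvgMr; apply: cvgB; last exact: cG.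
apply: (@continuous_comp _ _ _ (fun t => t + h) G); last exact: cG.
by apply: cvgD; [exact: cvg_id|exact: cvg_cst].
Qed.

Lemma continuous_integrable_itv (f : R -> R) (a b : R) : continuous f ->
  mu.-integrable `[a, b] (EFin \o f).
Proof.
move=> cf; apply: continuous_compact_integrable; first exact: segment_compact.
exact: continuous_subspaceT.
Qed.

(** The difference quotient of [G] is the derivative of the sliding mean of [G] over [[t, t + h]],
    so its integral is the difference of two such means. Each mean differs from the value of [G] by
    at most [K * h], whence the loss [2 * (K * h)]. *)
Lemma integral_diff_quotient_ge (G : R -> R) (K a b h : R) :
  a < b -> 0 <= K -> 0 < h -> (forall s t, `|G s - G t| <= K * `|s - t|) ->
  ((G b - G a - 2 * (K * h))%:E <=
    \int[mu]_(t in `[a, b]) (h^-1 * (G (t + h) - G t))%:E)%E.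
Proof.
move=> ab K0 h0 GL.
have cG := klipschitz_continuous _ _ K0 GL.
(* Starting the primitive at [a - 1] makes it differentiable at [a] itself. *)
pose Phi x := (\int[mu]_(t in `[a - 1, x]) G t)%R.
have dPhi x : a - 1 < x -> is_derive x 1 Phi (G x).
  move=> ax.
  have [||d e] := @continuous_FTC1_closed R G (a - 1) x (x + 1) _ _ ax (cG x).
  - by rewrite ltrDl.
  - exact: continuous_integrable_itv.
  - by rewrite -e derive1E; exact: derivableP.
pose Psi t : R := h^-1 * (Phi (t + h) - Phi t).
pose g t : R := h^-1 * (G (t + h) - G t).
have dPsi t : a - 1 < t -> is_derive t 1 (Psi) (g t).
  move=> at_; have h1 := dPhi _ at_.
  have h2 : is_derive t 1 (fun s => Phi (s + h)) (G (t + h)).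
    rewrite -[G _]mulr1; apply: (@is_derive_comp_fun _ (fun s => s + _)).
      by rewrite -[X in is_derive _ _ _ X]addr0; exact: is_deriveD_fun.
    by apply: dPhi; rewrite ltr_wpDr// ltW.
  apply: (is_derive_eq (is_deriveM_fun _ _ _ _ _ (is_derive_cst_fun h^-1 t)
    (is_deriveB_fun _ _ _ _ _ h2 h1))).
  by rewrite mul0r add0r.
have cg : continuous g by exact: continuous_diff_quotient.
have intg : (\int[mu]_(t in `[a, b]) (g t)%:E = (Psi b - Psi a)%:E)%E.
  apply: integral_is_derive => // t /[!in_itv]/= /andP[at_ _]; apply: dPsi.
  by rewrite (lt_le_trans _ at_)// ltrBlDr ltrDl.
have PsiE x : a <= x -> `|Psi x - G x| <= K * h.
  move=> ax; rewrite ler_distl.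
  have := @MVT_bounds Phi G x (x + h) (G x - K * h) (G x + K * h).
  have -> : x + h - x = h by rewrite addrAC subrr add0r.
  rewrite /Psi ler_pdivlMl// ler_pdivrMl// ![h * _]mulrC; apply.
  - by rewrite lerDl ltW.
  - by move=> t /andP[xt _]; apply: dPhi; lra.
  - move=> t /andP[xt tx]; rewrite -ler_distl (le_trans (GL _ _))//.
    by rewrite ler_wpM2l// ger0_norm ?subr_ge0// lerBlDl.
have := PsiE b (ltW ab); have := PsiE a (lexx a).
rewrite -/g intg lee_fin !ler_distl => /andP[_ h1] /andP[h2 _]; lra.
Qed.

Lemma clamp_lipschitz (a b s t : R) : a <= b ->
  `|Num.max a (Num.min s b) - Num.max a (Num.min t b)| <= `|s - t|.
Proof.
move=> ab; wlog st : s t / s <= t.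
  by move=> H; have [/H//|/ltW/H] := leP s t; rewrite distrC [`|t - s|]distrC.
set u := Num.max _ (Num.min t _); set v := Num.max _ _.
have : 0 <= u - v <= t - s.
  rewrite /u /v /Order.max /Order.min.
  by do !case: ifPn; rewrite -?leNgt => *; apply/andP; split; lra.
by rewrite ler_norml [`|s - t|]distrC => /andP[h1 h2]; rewrite ger0_norm; lra.
Qed.

(** Extended by constants outside [[a, b]], [F] has difference quotients bounded by [K], and their
    positive parts tend to 0 almost everywhere. By dominated convergence the integrals of these
    positive parts tend to 0, while they exceed [F b - F a] up to an error proportional to the
    step. *)
Lemma lipschitz_derive_le0 (F : R -> R) (a b K : R) : a < b ->
  {in `[a, b] &, forall s t, `|F s - F t| <= K * `|s - t|} ->
  {ae mu, forall t, t \in `[a, b] -> exists2 d : R, d <= 0 & is_derive t 1 F d} ->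
  F b <= F a.
Proof.
move=> ab FK F'_le0.
have K0 : 0 <= K.
  have := FK a b; rewrite !in_itv/= !lexx (ltW ab) => /(_ isT isT).
  move=> /(le_trans (normr_ge0 _)); rewrite pmulr_lge0// normr_gt0 subr_eq0.
  by rewrite lt_eqF.
pose cl t := Num.max a (Num.min t b).
have clab t : cl t \in `[a, b].
  by rewrite in_itv/= /cl le_max lexx/= ge_max (ltW ab)/= ge_min lexx orbT.
have clid t : t \in `[a, b] -> cl t = t.
  by rewrite in_itv/= /cl => /andP[at_ tb]; rewrite (min_idPl tb) (max_idPr at_).
have clL s t : `|cl s - cl t| <= `|s - t| by exact/clamp_lipschitz/ltW.
pose G t := F (cl t).
have GL s t : `|G s - G t| <= K * `|s - t|.
  by rewrite (le_trans (FK _ _ (clab s) (clab t)))// ler_wpM2l.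
have cG := klipschitz_continuous _ _ K0 GL.
pose g (n : nat) (t : R) : R := (n.+1%:R^-1)^-1 * (G (t + n.+1%:R^-1) - G t).
have Ga : G a = F a by rewrite /G clid// in_itv/= lexx ltW.
have Gb : G b = F b by rewrite /G clid// in_itv/= lexx ltW.
have n0 n : 0 < n.+1%:R^-1 :> R by rewrite invr_gt0.
have cg n : continuous (g n) by exact: continuous_diff_quotient.
have gK n t : `|g n t| <= K.
  rewrite /g normrM gtr0_norm ?invr_gt0// ler_pdivrMl//.
  by rewrite (le_trans (GL _ _))// [t + _]addrC addrK gtr0_norm// mulrC.
have mg n : measurable_fun `[a, b] (g n).
  apply: (measurable_funS measurableT) => //.
  exact: continuous_measurable_fun.
have mgm n : measurable_fun `[a, b] (g n \max cst 0) by exact: measurable_maxr.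
pose I n := (\int[mu]_(t in `[a, b]) (EFin \o (g n \max cst 0)%R) t)%E.
have cvg0 : I n @[n --> \oo] --> 0%E.
  have [||||||_ _] := @dominated_convergence _ _ _ mu `[a, b]%classic _
     (fun n => EFin \o (g n \max cst 0)) (cst 0%E) (cst K%:E).
  - exact: measurable_itv.
  - by move=> n; apply/measurable_EFinP; exact: mgm.
  - exact: measurable_cst.
  - apply: (ae_imp _ _ _ F'_le0) => t dF /= tab.
    (* At [t = b] the extension is constant to the right and the quotient is 0; for [t < b] a small
       step stays inside [[a, b]], so the quotient is that of [F]. *)
    have [tb|bt] := ltP t b; last first.
      have {tab}bt : t = b.
        apply/eqP; rewrite eq_le bt andbT.
        by have := tab; rewrite in_itv/= => /andP[].
      rewrite (_ : (fun n => _) = cst 0%E); first exact: cvg_cst.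
      apply/funext => n; rewrite /g bt /= /G.
      have -> : cl (b + n.+1%:R^-1) = cl b.
        by rewrite /cl !(min_idPr _)// lerDl ltW.
      by rewrite subrr mulr0 maxxx.
    have bt0 : 0 < b - t by rewrite subr_gt0.
    have [d d0 Fd] := dF tab.
    have dlim : h^-1 *: (F (h *: 1 + t) - F t) @[h --> 0^'] --> d.
      by case: Fd => dF' <-; exact: dF'.
    have {}dlim :
        n.+1%:R^-1^-1 *: (F (n.+1%:R^-1 *: 1 + t) - F t) @[n --> \oo] --> d.
      have /cvg_at_rightP := cvg_dnbhs_at_right dlim.
      by apply; split; [exact: n0|exact: cvg_harmonic].
    apply: cvg_EFin; first exact: nearW.
    apply/cvgrPdist_le => e e0; near=> n.
    have : `|d - n.+1%:R^-1^-1 *: (F (n.+1%:R^-1 *: 1 + t) - F t)| <= e.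
      by near: n; exact: cvgr_dist_le dlim _ e0.
    have -> : n.+1%:R^-1^-1 *: (F (n.+1%:R^-1 *: 1 + t) - F t) = g n t.
      have at_ : a <= t by have := tab; rewrite in_itv/= => /andP[].
      have tn : t + n.+1%:R^-1 <= b.
        rewrite -lerBrDl ltW//; near: n.
        exact: (near_infty_natSinv_lt (PosNum bt0)).
      rewrite /g /G !clid//; last by rewrite in_itv/= tn andbT ler_wpDr// ltW.
      have -> : n.+1%:R^-1%:A = n.+1%:R^-1 :> R by exact: mulr1.
      by rewrite (addrC _ t).
    move=> /ler_normlP[h1 h2]; have ge : g n t <= e by lra.
    change (`|0 - Num.max (g n t) 0| <= e); rewrite sub0r normrN.
    case: (leP (g n t) 0) => g0; first by rewrite normr0 ltW.
    by rewrite gtr0_norm.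
  - by apply: (continuous_integrable_itv (cst K)); exact: cst_continuous.
  - apply: aeW => t n _ /=; rewrite lee_fin.
    by case: (leP (g n t) 0) => _; rewrite ?normr0.
  - by rewrite integral_cst ?mul0e//; exact: measurable_itv.
have Kn0 : K * n.+1%:R^-1 @[n --> \oo] --> 0.
  by rewrite -[X in _ --> X](mulr0 K); apply: cvgMr; exact: cvg_harmonic.
rewrite -subr_le0 -lee_fin.
(* Passage to the limit in [F b - F a - 2 K / (n + 1) <= I n]. *)
apply: (@lee_cvg_to _ _ _ _ (fun n => (F b - F a - 2 * (K * n.+1%:R^-1))%:E)
  I _ _ _ cvg0).
  apply: cvg_EFin; first exact: nearW.
  rewrite -[X in _ --> X]subr0; apply: cvgB; first exact: cvg_cst.
  by rewrite -[X in _ --> X](mulr0 2); apply: cvgMr.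
apply: nearW => n.
apply: (@le_trans _ _ (\int[mu]_(t in `[a, b]) (g n t)%:E)%E).
  by have := integral_diff_quotient_ge _ _ _ _ _ ab K0 (n0 n) GL; rewrite Gb Ga.
apply: le_integral => //.
- exact: continuous_integrable_itv.
- apply: (@le_integrable _ _ _ mu _ _ _ (EFin \o cst K)) => //.
  + by apply/measurable_EFinP; exact: mgm.
  + move=> t _ /=; rewrite lee_fin.
    by rewrite (ger0_norm K0); case: (leP (g n t) 0) => _; rewrite ?normr0.
  + by apply: (continuous_integrable_itv (cst K)); exact: cst_continuous.
- by move=> t _; rewrite lee_fin le_max lexx.
Unshelve. all: by end_near. Qed.

End lipschitz_monotone.

(** * Coordinates of horizontal curves and their arclength function *)

Section arclength.
Context {R : realType}.
Local Notation mu := (@lebesgue_measure R).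

Lemma is_derive_fun_cvg (V : normedModType R) (f : R -> V) (t : R) (v : V) :
  h^-1 *: (f (h *: 1 + t) - f t) @[h --> 0^'] --> v -> is_derive t 1 f v.
Proof.
move=> fv; apply: DeriveDef; first by apply/cvg_ex; exists v.
by apply: cvg_lim => //; exact: norm_hausdorff.
Qed.

Lemma is_derive_fst (V W : normedModType R) (f : R -> V * W) (t : R) v :
  is_derive t 1 f v -> is_derive t 1 (fun s => (f s).1) v.1.
Proof.
move=> [df <-]; apply: is_derive_fun_cvg.
exact: (cvg_comp _ _ df (@cvg_fst _ _ _ _ _)).
Qed.

Lemma is_derive_snd (V W : normedModType R) (f : R -> V * W) (t : R) v :
  is_derive t 1 f v -> is_derive t 1 (fun s => (f s).2) v.2.
Proof.
move=> [df <-]; apply: is_derive_fun_cvg.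
exact: (cvg_comp _ _ df (@cvg_snd _ _ _ _ _)).
Qed.

Lemma is_derive_pair (V W : normedModType R) (f : R -> V) (g : R -> W) (t : R)
    v w : is_derive t 1 f v -> is_derive t 1 g w ->
  is_derive t 1 (fun s => (f s, g s)) (v, w).
Proof.
move=> [df <-] [dg <-]; apply: is_derive_fun_cvg.
exact: (cvg_pair df dg).
Qed.

(** An explicit constant makes stability under ring operations on a bounded interval easy to prove;
    [lip_poly] automates these rules. *)
Definition lipschitz_itv (a b : R) (f : R -> R) := exists2 K : R, 0 <= K &
  {in `[a, b] &, forall s t, `|f s - f t| <= K * `|s - t|}.

Lemma lipschitz_itv_cst a b (c : R) : lipschitz_itv a b (fun=> c).
Proof. by exists 0 => // s t _ _; rewrite subrr normr0 mul0r. Qed.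

Lemma lipschitz_itvD a b f g : lipschitz_itv a b f -> lipschitz_itv a b g ->
  lipschitz_itv a b (fun t => f t + g t).
Proof.
move=> [K K0 fK] [L L0 gL]; exists (K + L); first exact: addr_ge0.
move=> s t sab tab; rewrite mulrDl opprD addrACA (le_trans (ler_normD _ _))//.
by rewrite lerD ?fK ?gL.
Qed.

Lemma lipschitz_itv_id a b : lipschitz_itv a b id.
Proof. by exists 1 => // s t _ _; rewrite mul1r. Qed.

Lemma lipschitz_itv_bounded a b f : lipschitz_itv a b f ->
  exists M, forall t, t \in `[a, b] -> `|f t| <= M.
Proof.
move=> [k k0 fk]; exists (`|f a| + k * (b - a)).
move=> t /[dup] tab /[!in_itv]/= /andP[at_ tb].
have ab := le_trans at_ tb.
rewrite -lerBlDl (le_trans (lerB_dist _ _))// (le_trans (fk _ _ _ _))//.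
  by rewrite in_itv/= lexx.
by rewrite ler_wpM2l// ger0_norm ?lerD2r// subr_ge0.
Qed.

Lemma lipschitz_itvM a b f g : lipschitz_itv a b f -> lipschitz_itv a b g ->
  lipschitz_itv a b (fun t => f t * g t).
Proof.
move=> lf lg; have [M fM] := lipschitz_itv_bounded _ _ _ lf.
have [N gN] := lipschitz_itv_bounded _ _ _ lg.
have [K K0 fK] := lf; have [L L0 gL] := lg.
exists (`|M| * L + `|N| * K); first by rewrite addr_ge0// mulr_ge0.
move=> s t sab tab.
have -> : f s * g s - f t * g t = f s * (g s - g t) + g t * (f s - f t) by ring.
rewrite (le_trans (ler_normD _ _))// !normrM mulrDl -!mulrA.
rewrite lerD// ler_pM ?fK ?gL//.
  by rewrite (le_trans (fM _ _))// ler_norm.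
by rewrite (le_trans (gN _ _))// ler_norm.
Qed.

Lemma lipschitz_itvN a b f : lipschitz_itv a b f ->
  lipschitz_itv a b (fun t => - f t).
Proof.
move=> [K K0 fK]; exists K => // s t sab tab.
by rewrite -opprD normrN fK.
Qed.

Lemma lipschitz_itvX a b f n : lipschitz_itv a b f ->
  lipschitz_itv a b (fun t => f t ^+ n).
Proof.
move=> lf; elim: n => [|n IH]; first exact: lipschitz_itv_cst.
by under eq_fun do rewrite exprS; exact: lipschitz_itvM.
Qed.

(** Norms on products are maxima, so the sum of the three coordinate constants serves for
    [gamma]. *)
Lemma lipschitz_heis (a b : R) (gamma : R -> heis R) :
  [lipschitz gamma t | t in `[a, b]] <->
  [/\ lipschitz_itv a b (xc \o gamma), lipschitz_itv a b (yc \o gamma)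
    & lipschitz_itv a b (fun t => (gamma t).2)].
Proof.
split=> [gL|[[K K0 xK] [L L0 yL] [M M0 zM]]].
  have [M M0 gM] := pinfty_ex_gt0 gL.
  have h s1 s2 : s1 \in `[a, b] -> s2 \in `[a, b] ->
    `|gamma s1 - gamma s2| <= M * `|s1 - s2|.
    by move=> s1ab s2ab; exact: (gM (s1, s2)).
  split; exists M; rewrite ?ltW// => s1 s2 s1ab s2ab;
    apply: le_trans (h s1 s2 s1ab s2ab); rewrite !prod_normE !le_max lexx ?orbT//.
apply: filterS (nbhs_pinfty_ge (num_real (K + L + M))) => k kge -[s t] /= [sab tab].
apply: (@le_trans _ _ ((K + L + M) * `|s - t|)); last first.
  by rewrite ler_wpM2r.
rewrite !prod_normE !ge_max -andbA !mulrDl; apply/and3P; split.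
- by rewrite (le_trans (xK _ _ sab tab))// -addrA lerDl addr_ge0// mulr_ge0.
- by rewrite (le_trans (yL _ _ sab tab))// addrAC lerDr addr_ge0// mulr_ge0.
- by rewrite (le_trans (zM _ _ sab tab))// lerDr addr_ge0// mulr_ge0.
Qed.

Lemma hnorm_ge0 (u : R * R) : 0 <= hnorm u.
Proof. exact: sqrtr_ge0. Qed.

Lemma hnorm_sqr (u : R * R) : hnorm u ^+ 2 = u.1 ^+ 2 + u.2 ^+ 2.
Proof. by rewrite sqr_sqrtr// addr_ge0// sqr_ge0. Qed.

Lemma hnorm_le (u : R * R) : hnorm u <= `|u.1| + `|u.2|.
Proof.
rewrite -(ler_pXn2r (n := 2)) ?nnegrE ?hnorm_ge0 ?addr_ge0// hnorm_sqr.
rewrite sqrrD !real_normK ?num_real// -addrA [_ *+ 2 + _]addrC addrA lerDl.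
by rewrite mulrn_wge0// mulr_ge0.
Qed.

Lemma measurable_hnorm (D : set R) (u : R -> R * R) :
  measurable_fun D (fun t => (u t).1) -> measurable_fun D (fun t => (u t).2) ->
  measurable_fun D (fun t => hnorm (u t)).
Proof.
move=> m1 m2; apply: (@measurableT_comp _ _ _ _ _ _ (@Num.sqrt R)).
  by apply: continuous_measurable_fun; exact: sqrt_continuous.
by apply: measurable_funD; exact: measurable_funX.
Qed.

(** The speed is truncated at its essential bound and extended by 0, then integrated from minus
    infinity: the truncation makes [s] Lipschitz, and Lebesgue differentiation gives its derivative.
    Truncation alters the speed only on a null set and never increases it, so an inequality with the
    length is immediate, and it suffices for a lower bound on lengths. *)
Lemma horizontal_arclength (a b : R) gamma u : a < b ->
  horizontal_curve a b gamma u -> exists s : R -> R,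
  [/\ forall x y, x <= y -> s x <= s y,
      lipschitz_itv a b s,
      ((s b - s a)%:E <= hlength a b u)%E
    & {ae mu, forall t, t \in `[a, b] -> is_derive t 1 s (hnorm (u t))}].
Proof.
move=> ab [_ m1 m2 [M uM] _].
pose M' := `|M| + `|M|.
have M'0 : 0 <= M' by rewrite addr_ge0.
pose v t := Num.min (hnorm (u t)) M'.
pose w := v \_ `[a, b].
have w0 t : 0 <= w t.
  by rewrite /w patchE; case: ifPn => // _; rewrite le_min hnorm_ge0.
have wM t : w t <= M'.
  by rewrite /w patchE; case: ifPn => // _; rewrite ge_min lexx orbT.
have mw : measurable_fun [set: R] w.
  apply/(measurable_restrictT _ _).1 => //.
  by apply: measurable_minr => //; exact: measurable_hnorm.
have iw : mu.-integrable [set: R] (EFin \o w).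
  have mv : measurable_fun `[a, b] v.
    by apply: measurable_minr => //; exact: measurable_hnorm.
  have : mu.-integrable `[a, b] (EFin \o v).
    apply: (@le_integrable _ _ _ mu _ _ _ (EFin \o cst M')) => //.
    - exact/measurable_EFinP.
    - move=> t _ /=; rewrite lee_fin !ger0_norm ?le_min ?hnorm_ge0//.
      by rewrite ge_min lexx orbT.
    - by apply: (continuous_integrable_itv (cst M')); exact: cst_continuous.
  by rewrite integrable_mkcond//= restrict_EFin.
have iw' (A : set R) : measurable A -> mu.-integrable A (EFin \o w).
  by move=> mA; exact: integrableS iw.
pose s x := (\int[mu]_(t in `]-oo, x]) w t)%R.
have sB x y : x <= y -> s y - s x = \int[mu]_(t in `]x, y]) w t.
  move=> xy; rewrite /s Rintegral_itvB//.
  exact: iw'.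
have s_homo x y : x <= y -> s x <= s y.
  by move=> xy; rewrite -subr_ge0 sB// Rintegral_ge0.
exists s; split => //.
- exists M' => //.
  have h x y : x <= y -> `|s x - s y| <= M' * `|x - y|.
    move=> xy; rewrite distrC [`|x - y|]distrC !ger0_norm ?subr_ge0 ?s_homo//.
    rewrite sB//.
    have -> : M' * (y - x) = \int[mu]_(t in `]x, y]) M'.
      rewrite Rintegral_cst//= lebesgue_measure_itv/= lte_fin.
      case: ltP xy => //= yx xy.
      by rewrite mulr0 (@le_anti _ _ x y) ?subrr ?mulr0// xy.
    apply: le_Rintegral => //; first exact: iw'.
    apply: (@integrableS _ _ _ mu `[x, y]%classic) => //.
      exact: subset_itv_oc_cc.
    by apply: (continuous_integrable_itv (cst M')); exact: cst_continuous.
  move=> x y _ _; have [/h//|/ltW/h] := leP x y.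
  by rewrite distrC [`|y - x|]distrC.
- rewrite sB; last exact: ltW.
  rewrite /Rintegral fineK; last first.
    by apply: integrable_fin_num => //; exact: iw'.
  apply: (@le_trans _ _ (\int[mu]_(t in `[a, b]) (w t)%:E)%E).
    apply: ge0_subset_integral => //=.
    - by apply/measurable_EFinP; exact: measurable_funS mw.
    - by move=> t _; rewrite lee_fin.
    - exact: subset_itv_oc_cc.
  apply: ge0_le_integral => //=.
  - by move=> t _; rewrite lee_fin.
  - by apply/measurable_EFinP; exact: measurable_funS mw.
  - by apply/measurable_EFinP; exact: measurable_hnorm.
  - move=> t tab; rewrite lee_fin /w patchE; case: ifPn => _; last exact: hnorm_ge0.
    by rewrite ge_min lexx.
- have := FTC1Ny (fun y => iw' _ (measurable_itv `]-oo, y])).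
  move=> /(_ (open_integrable_locally openT iw)) sw.
  apply: (ae_imp2 _ _ _ _ sw uM) => t [ds sE] tM tab.
  apply: is_derive_eq; first exact: derivableP.
  rewrite -derive1E sE /w patchE mem_set// /v; apply/min_idPl.
  have [u1 u2] := tM tab; rewrite (le_trans (hnorm_le _))// lerD//.
    by rewrite (le_trans u1)// ler_norm.
  by rewrite (le_trans u2)// ler_norm.
Qed.

End arclength.

Ltac lip_poly := repeat first [eassumption | apply: lipschitz_itv_cst
  | apply: lipschitz_itv_id | apply: lipschitz_itvD | apply: lipschitz_itvN
  | apply: lipschitz_itvM | apply: lipschitz_itvX ].

(** * Lower bound of lengths by calibration *)

Section lower_bound.
Context {R : realType}.
Local Notation mu := (@lebesgue_measure R).
Implicit Types (lam sg L : R).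

(* [lam * phase lam sg] is [v + v^3/3 + 2 v^5/15 + v^7] with [v = lam sg / 2]:
   the expansion of [tan v] to order 6, the [v^7] term being chosen so large
   that [lam * phase] is a supersolution of the equation of [tan]. *)
Definition phase lam sg : R := sg / 2 + lam ^+ 2 * sg ^+ 3 / 24
  + lam ^+ 4 * sg ^+ 5 / 240 + lam ^+ 6 * sg ^+ 7 / 128.

Definition phase' lam sg : R := 1 / 2 + lam ^+ 2 * sg ^+ 2 / 8
  + lam ^+ 4 * sg ^+ 4 / 48 + 7 * lam ^+ 6 * sg ^+ 6 / 128.

Lemma is_derive_phase lam sg : is_derive sg 1 (phase lam) (phase' lam sg).
Proof.
rewrite /phase; apply: is_derive_eq.
by rewrite /phase' /GRing.scale/=; field.
Qed.

(** As polynomials in [y = (lam sg)^2] the two sides agree through [y^2]. The term [7 y^3 / 128] on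
    the right absorbs all that remains on the left, because [y <= 1]. *)
Lemma phase'_ge lam sg : `|lam| <= 1 -> `|sg| <= 2^-1 ->
  (1 + lam ^+ 2 * phase lam sg ^+ 2) / 2 <= phase' lam sg.
Proof.
move=> lam1 sg1; pose y := (lam * sg) ^+ 2.
have y0 : 0 <= y by exact: sqr_ge0.
have y1 : y <= 1.
  rewrite /y -real_normK ?num_real// normrM exprn_ile1 ?mulr_ge0//.
  by rewrite mulr_ile1// (le_trans sg1)// invf_le1// ler1n.
have -> : lam ^+ 2 * phase lam sg ^+ 2 =
    y * (1 / 2 + y / 24 + y ^+ 2 / 240 + y ^+ 3 / 128) ^+ 2.
  by rewrite /phase /y; field.
have -> : phase' lam sg = 1 / 2 + y / 8 + y ^+ 2 / 48 + 7 * y ^+ 3 / 128.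
  by rewrite /phase' /y; field.
pose r := y / 24 + y ^+ 2 / 240 + y ^+ 3 / 128.
have y21 : y ^+ 2 <= y by rewrite expr2 ler_piMr.
have y32 : y ^+ 3 <= y ^+ 2 by rewrite exprS ler_piMl// exprn_ge0.
have y43 : y ^+ 4 <= y ^+ 3 by rewrite exprS ler_piMl// exprn_ge0.
have y20 : 0 <= y ^+ 2 by rewrite exprn_ge0.
have y30 : 0 <= y ^+ 3 by rewrite exprn_ge0.
have r0 : 0 <= r by rewrite /r; lra.
(* Indeed [1/24 + 1/240 + 1/128 < 1/18]. *)
have ry : r <= y / 18 by rewrite /r; lra.
have : y * r ^+ 2 <= y * (y / 18) ^+ 2.
  by rewrite ler_wpM2l// lerXn2r// nnegrE// (le_trans r0).
have -> : 1 / 2 + y / 24 + y ^+ 2 / 240 + y ^+ 3 / 128 = 1 / 2 + r.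
  by rewrite /r; ring.
have yrE : y * r = y ^+ 2 / 24 + y ^+ 3 / 240 + y ^+ 4 / 128 by rewrite /r; field.
have -> : y * (1 / 2 + r) ^+ 2 = y / 4 + y * r + y * r ^+ 2 by field.
rewrite yrE (_ : y * (y / 18) ^+ 2 = y ^+ 3 / 324); last by field.
lra.
Qed.

Lemma dot_le_hnorm (u v : R * R) :
  u.1 * v.1 + u.2 * v.2 <= hnorm u * hnorm v.
Proof.
apply: le_trans (ler_norm _) _.
rewrite -(ler_pXn2r (n := 2)) ?nnegrE ?mulr_ge0 ?hnorm_ge0//.
rewrite real_normK ?num_real// exprMn !hnorm_sqr -subr_ge0.
rewrite (_ : _ - _ = (u.1 * v.2 - u.2 * v.1) ^+ 2) ?sqr_ge0//; ring.
Qed.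

(** With [n = (n1, n2)] and [v = i n - p lam n], the terms linear in [u] form the scalar product of
    [u] and [v], and the Riccati inequality gives [|v|^2 <= 2 p' |n|^2]. Cauchy-Schwarz then leaves
    [|u| (m - m^2 / (4 L))] with [m = |v|], and completing the square bounds it by [|u| L]. *)
Lemma hamilton_jacobi_le lam L p p' n1 n2 (u : R * R) : 0 < L ->
  (1 + lam ^+ 2 * p ^+ 2) / 2 <= p' ->
  u.2 * n1 - u.1 * n2 - p * lam * (n1 * u.1 + n2 * u.2)
    - p' * hnorm u * (n1 ^+ 2 + n2 ^+ 2) / (2 * L) <= hnorm u * L.
Proof.
move=> L0 pp'.
pose v : R * R := (- n2 - p * lam * n1, n1 - p * lam * n2).
have -> : u.2 * n1 - u.1 * n2 - p * lam * (n1 * u.1 + n2 * u.2) =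
    u.1 * v.1 + u.2 * v.2 by rewrite /v /=; ring.
have := dot_le_hnorm u v; have := hnorm_sqr v.
have -> : v.1 ^+ 2 + v.2 ^+ 2 = (n1 ^+ 2 + n2 ^+ 2) * (1 + lam ^+ 2 * p ^+ 2).
  by rewrite /v /=; ring.
have N0 : 0 <= n1 ^+ 2 + n2 ^+ 2 by rewrite addr_ge0// sqr_ge0.
have w0 := hnorm_ge0 u.
set N := n1 ^+ 2 + n2 ^+ 2 in N0 *; set d := u.1 * v.1 + u.2 * v.2.
move: N N0 (hnorm u) w0 (hnorm v) d => N N0 w w0 m d mE dle.
have h : m ^+ 2 / 2 <= p' * N by rewrite mE -mulrA mulrC ler_wpM2r.
have : m - m ^+ 2 / (4 * L) <= L.
  rewrite -subr_ge0 (_ : _ - _ = (m - 2 * L) ^+ 2 / (4 * L)); last first.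
    by field; rewrite gt_eqF.
  by rewrite divr_ge0 ?sqr_ge0// mulr_ge0// ltW.
move=> /(ler_wpM2l w0) h2; apply: le_trans h2.
rewrite mulrBr; apply: lerB => //.
rewrite (_ : w * _ = w * (m ^+ 2 / 2) / (2 * L)); last by field; rewrite gt_eqF.
rewrite ler_pM2r ?invr_gt0 ?mulr_gt0//.
rewrite [leRHS](_ : _ = w * (p' * N)) ?ler_wpM2l//; ring.
Qed.

Lemma hvecE (p : heis R) (u : R * R) :
  hvec p u = (u.1, u.2, (xc p * u.2 - yc p * u.1) / 2).
Proof.
transitivity (u.1 * 1 + u.2 * 0, u.1 * 0 + u.2 * 1,
  u.1 * - (yc p / 2) + u.2 * (xc p / 2)) => //.
by congr (_, _, _); [ring|ring|field].
Qed.

(* With s the arclength, q = (x, y), B = (B1, B2), i the rotation of angle pi/2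
   and sg = s / L - 1/2, the function
     2 lam z + <B, q> - phase lam sg / 2 * |lam q - i B|^2
   grows along the curve at speed at most L |u|. *)
Lemma heis_length_ge (a b : R) (gamma : R -> heis R) u lam L B1 B2 x y z :
  a < b -> horizontal_curve a b gamma u -> (hlength a b u <= L%:E)%E ->
  0 < L -> `|lam| <= 1 ->
  x = xc (gamma b) - xc (gamma a) -> y = yc (gamma b) - yc (gamma a) ->
  z = (gamma b).2 - (gamma a).2
    - (xc (gamma a) * y - yc (gamma a) * x) / 2 ->
  2 * lam * z + B1 * x + B2 * y - phase lam 2^-1 / 2 *
    ((lam * x + B2) ^+ 2 + (lam * y - B1) ^+ 2 + B1 ^+ 2 + B2 ^+ 2) <= L ^+ 2.
Proof.
move=> ab hc lL L0 lam1.
have [s [s_homo sL sl s']] := horizontal_arclength _ _ _ _ ab hc.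
have {lL}sbL : s b - s a <= L by rewrite -lee_fin (le_trans sl lL).
case: hc => gL _ _ _ g'.
set x0 := xc (gamma a); set y0 := yc (gamma a); set z0 := (gamma a).2.
move=> xE yE zE.
pose X t := xc (gamma t); pose Y t := yc (gamma t); pose Z t := (gamma t).2.
have [XL YL ZL] : [/\ lipschitz_itv a b X, lipschitz_itv a b Y
    & lipschitz_itv a b Z] := (lipschitz_heis _ _ _).1 gL.
pose sg t := (s t - s a) / L - 2^-1.
(* This is the calibrating function in coordinates translated to start at the origin, minus [L * s],
   so that the growth estimate becomes monotonicity. *)
pose F t := 2 * lam * (Z t - z0 - (x0 * (Y t - y0) - y0 * (X t - x0)) / 2)
  + B1 * (X t - x0) + B2 * (Y t - y0)
  - phase lam (sg t) / 2 *
    ((lam * (X t - x0) + B2) ^+ 2 + (lam * (Y t - y0) - B1) ^+ 2)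
  - L * s t.
have [K K0 FK] : lipschitz_itv a b F.
  rewrite /F /phase; have sgL : lipschitz_itv a b sg by rewrite /sg; lip_poly.
  by clearbody X Y Z sg; lip_poly.
have sgab t : t \in `[a, b] -> `|sg t| <= 2^-1.
  rewrite in_itv/= => /andP[at_ tb]; rewrite ler_norml /sg.
  have : 0 <= (s t - s a) / L by rewrite divr_ge0 ?subr_ge0 ?s_homo// ltW.
  have : (s t - s a) / L <= 1.
    by rewrite ler_pdivrMr// mul1r (le_trans _ sbL)// lerD2r s_homo.
  by move=> ? ?; apply/andP; split; lra.
have Fba : F b <= F a.
  apply: (@lipschitz_derive_le0 _ F a b K ab FK).
  apply: (ae_imp2 _ _ _ _ s' g') => t st gt tab.
  have {}st := st tab; have {}gt := gt tab.
  have Xt : is_derive t 1 X (u t).1.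
    apply: is_derive_eq; first exact: is_derive_fst (is_derive_fst _ _ _ _ _ gt).
    by rewrite hvecE.
  have Yt : is_derive t 1 Y (u t).2.
    apply: is_derive_eq; first exact: is_derive_snd (is_derive_fst _ _ _ _ _ gt).
    by rewrite hvecE.
  have Zt : is_derive t 1 Z ((X t * (u t).2 - Y t * (u t).1) / 2).
    apply: is_derive_eq; first exact: is_derive_snd gt.
    by rewrite hvecE.
  have sgt : is_derive t 1 sg (hnorm (u t) / L).
    by rewrite /sg; apply: is_derive_eq; rewrite /GRing.scale/=; ring.
  have pt : is_derive t 1 (fun t => phase lam (sg t))
      (phase' lam (sg t) * (hnorm (u t) / L)).
    exact: is_derive_comp_fun _ _ _ _ _ sgt (is_derive_phase _ _).
  set n1 := lam * (X t - x0) + B2; set n2 := lam * (Y t - y0) - B1.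
  set p := phase lam (sg t); set p' := phase' lam (sg t); set w := hnorm (u t).
  have := hamilton_jacobi_le lam L p p' n1 n2 (u t) L0
    (phase'_ge _ _ lam1 (sgab _ tab)).
  rewrite -subr_le0; eexists; first eassumption.
  rewrite /F; apply: is_derive_eq.
  by rewrite /GRing.scale/= /n1 /n2 -/p -/p' -/w /=; field; rewrite gt_eqF.
have sga : sg a = - 2^-1 by rewrite /sg subrr mul0r sub0r.
have phaseN r : phase lam (- r) = - phase lam r by rewrite /phase; field.
have bab : b \in `[a, b] by rewrite in_itv/= lexx ltW.
have sgXb n : sg b ^+ n <= 2^-1 ^+ n.
  rewrite (le_trans (ler_norm _))// normrX lerXn2r ?nnegrE ?invr_ge0//.
  exact: sgab.
(* The curve may be shorter than [L], so [sg b] may be below 1/2; as [phase] is increasing,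
   replacing its end value by the one at 1/2 only weakens the bound. At [a] oddness of [phase]
   produces the term in [B1 ^+ 2 + B2 ^+ 2]. *)
have sgb : phase lam (sg b) <= phase lam 2^-1.
  rewrite /phase !lerD//.
  - by rewrite ler_pM2r ?invr_gt0// -[sg b]expr1 -[leRHS]expr1.
  - apply: ler_wpM2r; first by rewrite invr_ge0; exact: ler0n.
    by rewrite ler_wpM2l// exprn_even_ge0.
  - apply: ler_wpM2r; first by rewrite invr_ge0; exact: ler0n.
    by rewrite ler_wpM2l// exprn_even_ge0.
  - apply: ler_wpM2r; first by rewrite invr_ge0; exact: ler0n.
    by rewrite ler_wpM2l// exprn_even_ge0.
move: Fba; rewrite /F sga phaseN /X /Y /Z -/x0 -/y0 -/z0 -xE -yE -zE !subrr.
set N := (lam * x + B2) ^+ 2 + _.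
have N0 : 0 <= N by rewrite addr_ge0// sqr_ge0.
have := ler_wpM2r N0 sgb.
have := ler_wpM2l (ltW L0) sbL.
move: (phase lam (sg b)) (phase lam 2^-1) => p1 p2.
move=> h1 h2 h3.
have -> : (lam * x + B2) ^+ 2 + (lam * y - B1) ^+ 2 + B1 ^+ 2 + B2 ^+ 2 =
   N + (B1 ^+ 2 + B2 ^+ 2) by rewrite /N; ring.
lra.
Qed.

End lower_bound.

(** * Upper bound of the distance by an explicit polynomial curve *)

Section upper_bound.
Context {R : realType}.
Local Notation mu := (@lebesgue_measure R).

Lemma horizontal_curve_lift (a b : R) (X Y Z U V : R -> R) :
  (forall t : R, is_derive t 1 X (U t)) -> (forall t : R, is_derive t 1 Y (V t)) ->
  (forall t : R, is_derive t 1 Z ((X t * V t - Y t * U t) / 2)) ->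
  lipschitz_itv a b X -> lipschitz_itv a b Y -> lipschitz_itv a b Z ->
  lipschitz_itv a b U -> lipschitz_itv a b V ->
  continuous U -> continuous V ->
  horizontal_curve a b (fun t => (X t, Y t, Z t)) (fun t => (U t, V t)).
Proof.
move=> dX dY dZ lX lY lZ lU lV cU cV; split.
- exact/lipschitz_heis.
- by apply: (measurable_funS measurableT) => //; exact: continuous_measurable_fun.
- by apply: (measurable_funS measurableT) => //; exact: continuous_measurable_fun.
- have [M UM] := lipschitz_itv_bounded _ _ _ lU.
  have [N VN] := lipschitz_itv_bounded _ _ _ lV.
  exists (Num.max M N); apply: aeW => t tab /=.
  by rewrite !le_max UM// VN// orbT.
- apply: aeW => t _; rewrite hvecE /=.
  by apply: is_derive_pair; first exact: is_derive_pair.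
Qed.

(* In the frame with first axis [(p, q)], the planar curve has velocity
   [(1 - n (s^2 - 1/12), m s)], a truncation of the velocity of a circle arc;
   for all [m] and [n] it spans the whole chord [(p, q)]. *)
Lemma heis_dist_le (A B : heis R) (p q c m n e : R) : 0 < e ->
  c = p ^+ 2 + q ^+ 2 ->
  B = (xc A + p, yc A + q,
    A.2 + (xc A * q - yc A * p) / 2 + c * (m / 12 + m * n / 360)) ->
  (heis_dist A B <= ((c * (1 + m ^+ 2 / 12 + n ^+ 2 / 180) / e + e) / 2)%:E)%E.
Proof.
move=> e0 cE ->.
pose a : R := - 2^-1; pose b : R := 2^-1.
have ab : a < b by rewrite /a /b; lra.
(* The mean of [s^2] on [[-1/2, 1/2]] is 1/12: [f] runs from 0 to 1 for every [n], and [g] vanishes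
   at both ends. *)
pose f (s : R) := s + 1 / 2 - n * (s ^+ 3 / 3 - s / 12).
pose g (s : R) := m * (s ^+ 2 - 1 / 4) / 2.
pose f' (s : R) := 1 - n * (s ^+ 2 - 1 / 12).
pose g' (s : R) := m * s.
(* The area swept by [(f, g)] since [s = -1/2], equal to [m / 12 + m n / 360] at the end. Rotating
   and scaling by [(p, q)] multiplies areas by [c]. *)
pose k (s : R) := m / 2 * (s ^+ 3 / 6 + s ^+ 2 / 4 + s / 8 + 1 / 48
  + n * (s ^+ 5 / 30 - s ^+ 3 / 36 + s / 96 + 1 / 360)).
have df (s : R) : is_derive s 1 f (f' s).
  by apply: is_derive_eq; rewrite /f' /GRing.scale/=; field.
have dg (s : R) : is_derive s 1 g (g' s).
  by apply: is_derive_eq; rewrite /g' /GRing.scale/=; field.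
have dk (s : R) : is_derive s 1 k ((f s * g' s - g s * f' s) / 2).
  by apply: is_derive_eq; rewrite /f /g /f' /g' /GRing.scale/=; field.
pose X s := xc A + (p * f s - q * g s).
pose Y s := yc A + (q * f s + p * g s).
pose Z s := A.2 + (xc A * (q * f s + p * g s) - yc A * (p * f s - q * g s)) / 2
  + c * k s.
pose U s := p * f' s - q * g' s.
pose V s := q * f' s + p * g' s.
have dU (s : R) : is_derive s 1 U (- p * n * 2 * s - q * m).
  by apply: is_derive_eq; rewrite /GRing.scale/=; ring.
have dV (s : R) : is_derive s 1 V (- q * n * 2 * s + p * m).
  by apply: is_derive_eq; rewrite /GRing.scale/=; ring.
have cU : continuous U by move=> s; exact: is_derive_continuous (dU s).
have cV : continuous V by move=> s; exact: is_derive_continuous (dV s).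
have hc : horizontal_curve a b (fun s => (X s, Y s, Z s)) (fun s => (U s, V s)).
  apply: (horizontal_curve_lift a b X Y Z U V); last 2 first.
  - exact: cU.
  - exact: cV.
  - by move=> s; apply: is_derive_eq; rewrite /U /GRing.scale/=; ring.
  - by move=> s; apply: is_derive_eq; rewrite /V /GRing.scale/=; ring.
  - move=> s; apply: is_derive_eq.
    by rewrite /U /V /X /Y cE /GRing.scale/=; field.
  - by rewrite /X /f /g; lip_poly.
  - by rewrite /Y /f /g; lip_poly.
  - by rewrite /Z /f /g /k; clear; lip_poly.
  - by rewrite /U /f' /g'; lip_poly.
  - by rewrite /V /f' /g'; lip_poly.
apply: (@le_trans _ _ (hlength a b (fun s => (U s, V s)))).
  apply: ereal_inf_lbound.
  exists a, b, (fun s => (X s, Y s, Z s)), (fun s => (U s, V s)).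
  split => //; first exact: ltW.
  - rewrite [A]surjective_pairing [A.1]surjective_pairing.
    by congr (_, _, _); rewrite /X /Y /Z /f /g /k /a /xc /yc; field.
  - by congr (_, _, _); rewrite /X /Y /Z /f /g /k /b; field.
(* The inequality [v <= (v^2 / e + e) / 2] replaces the speed by a polynomial, of which [W] is a
   primitive. *)
pose w s := (c * (f' s ^+ 2 + g' s ^+ 2) / e + e) / 2.
pose W s := (c * (s - 2 * n * (s ^+ 3 / 3 - s / 12)
   + n ^+ 2 * (s ^+ 5 / 5 - s ^+ 3 / 18 + s / 144) + m ^+ 2 * s ^+ 3 / 3) / e
   + e * s) / 2.
have e_neq0 : e != 0 by rewrite gt_eqF.
have dW (s : R) : is_derive s 1 W (w s).
  by apply: is_derive_eq; rewrite /w /f' /g' /GRing.scale/=; field.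
have cw : continuous w.
  have dw (s : R) : is_derive s 1 w
      ((c * (2 * f' s * (- (2 * n * s)) + 2 * g' s * m) / e) / 2).
    by apply: is_derive_eq; rewrite /f' /g' /GRing.scale/=; field.
  by move=> s; exact: is_derive_continuous (dw s).
apply: (@le_trans _ _ (\int[mu]_(s in `[a, b]) (w s)%:E)%E).
  apply: ge0_le_integral => //=.
  - by move=> s _; rewrite lee_fin hnorm_ge0.
  - apply/measurable_EFinP; apply: measurable_hnorm.
      by case: hc.
    by case: hc.
  - by apply/measurable_EFinP; apply: (measurable_funS measurableT) => //;
      exact: continuous_measurable_fun.
  - move=> s _; rewrite lee_fin /w.
    have := hnorm_sqr (U s, V s); set h := hnorm _ => /= hE.
    have -> : c * (f' s ^+ 2 + g' s ^+ 2) = h ^+ 2.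
      by rewrite hE /U /V cE; ring.
    rewrite -subr_ge0 (_ : _ - _ = (h - e) ^+ 2 / e / 2); last by field.
    by rewrite !divr_ge0 ?sqr_ge0// ltW.
rewrite (integral_is_derive W)// lee_fin le_eqVlt; apply/orP; left; apply/eqP.
by rewrite /W /a /b; field.
Qed.

End upper_bound.

(** * Calculus of Taylor expansions at 0 with remainder of a given order *)

Section jets.
Context {R : realType}.
Implicit Types (f g : R -> R) (p : {poly R}).

(* The neighbourhoods are punctured because of the junk value of [f t / t ^+ k]
   at 0. *)
Definition flat (n : nat) (f : R -> R) : Prop :=
  exists M : R, \forall t \near 0^', `|f t| <= M * `|t| ^+ n.

Lemma flatP n f : flat n f -> exists2 M : R, 0 <= M &
  \forall t \near 0^', `|f t| <= M * `|t| ^+ n.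
Proof.
move=> [M fM]; exists `|M| => //; near=> t.
have : `|f t| <= M * `|t| ^+ n by near: t.
by move/le_trans; apply; rewrite ler_wpM2r ?exprn_ge0// ler_norm.
Unshelve. all: by end_near. Qed.

Lemma eq_flat n f g : (\forall t \near 0^', f t = g t) -> flat n f -> flat n g.
Proof.
move=> fg [M fM]; exists M; near=> t.
have <- : f t = g t by near: t.
by near: t.
Unshelve. all: by end_near. Qed.

Lemma flatD n f g : flat n f -> flat n g -> flat n (fun t => f t + g t).
Proof.
move=> [M fM] [N gN]; exists (M + N); near=> t.
rewrite (le_trans (ler_normD _ _))// mulrDl lerD//; by near: t.
Unshelve. all: by end_near. Qed.

Lemma flatM m n f g : flat m f -> flat n g ->
  flat (m + n) (fun t => f t * g t).
Proof.
move=> [M fM] [N gN]; exists (M * N); near=> t.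
by rewrite normrM exprD mulrACA ler_pM//; near: t.
Unshelve. all: by end_near. Qed.

Lemma flat_cst (c : R) : flat 0 (fun=> c).
Proof.
by exists `|c|; near=> t; rewrite expr0 mulr1.
Unshelve. all: by end_near. Qed.

Lemma flat_exprn n : flat n (fun t => t ^+ n).
Proof.
by exists 1; near=> t; rewrite mul1r normrX.
Unshelve. all: by end_near. Qed.

Lemma near0_ball (e : R) : 0 < e -> \forall t \near (0 : R)^', `|t| <= e.
Proof. by move=> e0; apply: dnbhs0_le. Qed.

Lemma flatW m n f : (n <= m)%N -> flat m f -> flat n f.
Proof.
move=> nm /flatP[M M0 fM]; exists M; near=> t.
have : `|f t| <= M * `|t| ^+ m by near: t.
move/le_trans; apply; rewrite ler_wpM2l// ler_wiXn2l//.
by near: t; exact: near0_ball.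
Unshelve. all: by end_near. Qed.

Lemma flat_continuous f : {for 0, continuous f} -> flat 0 f.
Proof.
move=> cf; exists (`|f 0| + 1).
apply: cvg_within; near=> t; rewrite expr0 mulr1.
have : `|f 0 - f t| <= 1 by near: t; exact: cvgr_dist_le cf _ ltr01.
by rewrite distrC => h; rewrite -lerBlDl (le_trans (lerB_dist _ _)).
Unshelve. all: by end_near. Qed.

Lemma flat_horner p : flat 0 (horner p).
Proof. by apply: flat_continuous; exact: continuous_horner. Qed.

(** The mean value theorem gives [f t = f' c * t] with [0 < |c| < |t|]; since [c] is never 0, a
    bound on the punctured neighbourhood suffices. *)
Lemma flat_primitive n f f' :
    (\forall t \near (0 : R), is_derive (t : R) (1 : R) f (f' t)) ->
  f 0 = 0 -> flat n f' -> flat n.+1 f.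
Proof.
move=> /nbhs_ballP[e e0 df] f0 /flatP[M M0]; rewrite /dnbhs /within.
move=> /nbhs_ballP[d d0 fM]; exists M.
have m0 : 0 < Num.min e d by rewrite lt_min e0 d0.
have key t c : `|t| < Num.min e d -> 0 < `|c| < `|t| -> f t = f' c * t ->
    `|f t| <= M * `|t| ^+ n.+1.
  rewrite lt_min => /andP[te td] /andP[c0 ct] ->.
  rewrite normrM exprSr mulrA ler_wpM2r//.
  apply: (le_trans (fM c _ _)).
  - by rewrite /ball/= sub0r normrN (lt_trans ct).
  - by rewrite -normr_gt0.
  - by rewrite ler_wpM2l// lerXn2r ?nnegrE// ltW.
near=> t.
have tm : `|t| < Num.min e d by near: t; exact: dnbhs0_lt.
have t0 : t != 0 by near: t; exact: nbhs_dnbhs_neq.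
have te : `|t| < e by move: tm; rewrite lt_min => /andP[].
have dft (s : R) : `|s| <= `|t| -> is_derive s 1 f (f' s).
  by move=> st; apply: df; rewrite /ball/= sub0r normrN (le_lt_trans st).
have cft (a b : R) : (forall s : R, s \in `[a, b] -> `|s| <= `|t|) ->
    {within `[a, b], continuous f}.
  move=> h; apply: derivable_within_continuous => s /h st.
  by apply: ex_derive; exact: dft.
case: (ltgtP t 0) t0 => // t0 _.
- have [||c] := @MVT _ f f' t 0 t0.
  + move=> s; rewrite in_itv/= => /andP[ts s0]; apply: dft.
    by rewrite !ltr0_norm// lerN2 ltW.
  + apply: cft => s; rewrite in_itv/= => /andP[ts s0].
    by rewrite (ltr0_norm t0) (ler0_norm s0) lerN2.
  rewrite in_itv/= f0 !sub0r => /andP[tc c0] h.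
  apply: (key t c) => //; first by rewrite !ltr0_norm// oppr_gt0 c0 ltrN2.
  by apply: oppr_inj; rewrite h mulrN.
- have [||c] := @MVT _ f f' 0 t t0.
  + move=> s; rewrite in_itv/= => /andP[s0 st]; apply: dft.
    by rewrite !gtr0_norm// ltW.
  + apply: cft => s; rewrite in_itv/= => /andP[s0 st].
    by rewrite (gtr0_norm t0) (ger0_norm s0).
  rewrite in_itv/= f0 !subr0 => /andP[c0 ct] h.
  by apply: (key t c) => //; rewrite !gtr0_norm// c0.
Unshelve. all: by end_near. Qed.

(** Coefficients are kept in a list with default 0, so that operations on expansions reduce to
    finitely many scalar identities. Entries of index at least [n] are absorbed by the remainder. *)
Definition jet (n : nat) (f : R -> R) (s : seq R) : Prop :=
  flat n (fun t => f t - (Poly s).[t]).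

Lemma jet_flat n f : jet n f [::] -> flat n f.
Proof.
by apply: eq_flat; near=> t; rewrite horner0 subr0.
Unshelve. all: by end_near. Qed.

Lemma flat_poly n p : (forall i, (i < n)%N -> p`_i = 0) -> flat n (horner p).
Proof.
move=> p0; have -> : p = drop_poly n p * 'X^n.
  rewrite -[LHS](poly_take_drop n) (_ : take_poly n p = 0) ?add0r//.
  by apply/polyP => i; rewrite coef_take_poly coef0; case: ifP => // /p0.
rewrite (_ : horner _ = fun t => (drop_poly n p).[t] * t ^+ n); last first.
  by apply/funext => t; rewrite hornerM hornerXn.
by apply: (flatM 0); [exact: flat_horner|exact: flat_exprn].
Qed.

Lemma jet_poly n f p s : flat n (fun t => f t - p.[t]) ->
  (forall i, (i < n)%N -> p`_i = s`_i) -> jet n f s.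
Proof.
move=> fp ps.
have h : flat n (horner (p - Poly s)).
  by apply: flat_poly => i /ps; rewrite coefB coef_Poly => ->; rewrite subrr.
apply: eq_flat (flatD _ _ _ fp h); near=> t.
by rewrite hornerD hornerN addrA subrK.
Unshelve. all: by end_near. Qed.

Lemma eq_jet n f g s r : (\forall t \near 0^', f t = g t) ->
  (forall i, (i < n)%N -> s`_i = r`_i) -> jet n f s -> jet n g r.
Proof.
move=> fg sr fs; apply: (jet_poly _ _ (Poly s)).
  apply: eq_flat fs; near=> t; congr (_ - _); by near: t.
by move=> i /sr <-; rewrite coef_Poly.
Unshelve. all: by end_near. Qed.

Lemma jetM n f g s r u : jet n f s -> jet n g r ->
  (forall i, (i < n)%N -> \sum_(j < i.+1) s`_j * r`_(i - j) = u`_i) ->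
  jet n (fun t => f t * g t) u.
Proof.
move=> fs gr su; apply: (jet_poly _ _ (Poly s * Poly r)); last first.
  move=> i /su <-; rewrite coefM; apply: eq_bigr => j _.
  by rewrite !coef_Poly.
have h1 : flat n (fun t => (f t - (Poly s).[t]) * (g t - (Poly r).[t])).
  by apply: (flatW (n + n)); [exact: leq_addr|exact: flatM].
have h2 : flat n (fun t => (f t - (Poly s).[t]) * (Poly r).[t]).
  by rewrite -[n]addn0; apply: flatM => //; exact: flat_horner.
have h3 : flat n (fun t => (Poly s).[t] * (g t - (Poly r).[t])).
  by rewrite -[n]add0n; apply: flatM => //; exact: flat_horner.
apply: eq_flat (flatD _ _ _ h1 (flatD _ _ _ h2 h3)); near=> t.
by rewrite hornerM; ring.
Unshelve. all: by end_near. Qed.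

Lemma jet_lin n f g s r u (a b : R) : jet n f s -> jet n g r ->
  (forall i, (i < n)%N -> a * s`_i + b * r`_i = u`_i) ->
  jet n (fun t => a * f t + b * g t) u.
Proof.
move=> fs gr su; apply: (jet_poly _ _ (a *: Poly s + b *: Poly r)); last first.
  by move=> i /su <-; rewrite coefD !coefZ !coef_Poly.
have h1 := flatM _ _ _ _ (flat_cst a) fs.
have h2 := flatM _ _ _ _ (flat_cst b) gr.
apply: eq_flat (flatD _ _ _ h1 h2); near=> t.
by rewrite hornerD !hornerZ; ring.
Unshelve. all: by end_near. Qed.

Lemma jet_Poly n s : jet n (horner (Poly s)) s.
Proof.
apply: (jet_poly _ _ (Poly s)); last by move=> i _; rewrite coef_Poly.
apply: eq_flat (flatM _ _ _ _ (flat_cst 0) (flat_exprn n)); near=> t.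
by rewrite subrr mul0r.
Unshelve. all: by end_near. Qed.

Lemma jet_primitive n f f' s s' :
    (\forall t \near (0 : R), is_derive (t : R) (1 : R) f (f' t)) ->
  jet n f' s' -> f 0 = s`_0 ->
  (forall i, (i < n)%N -> s'`_i = s`_i.+1 *+ i.+1) -> jet n.+1 f s.
Proof.
move=> df fs' f0 ss'.
have h : flat n (fun t => f' t - (Poly s)^`().[t]).
  have h : flat n (horner (Poly s' - (Poly s)^`())).
    apply: flat_poly => i /ss'.
    by rewrite coefB coef_deriv !coef_Poly => ->; rewrite subrr.
  apply: eq_flat (flatD _ _ _ fs' h); near=> t.
  by rewrite hornerD hornerN addrA subrK.
apply: flat_primitive h; last by rewrite f0 horner_coef0 coef_Poly subrr.
apply: filterS df => t ft; apply: is_deriveB_fun => //.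
Unshelve. all: by end_near. Qed.

Lemma jet_shift n k f s : jet n f s ->
  jet (k + n) (fun t => t ^+ k * f t) (nseq k 0 ++ s).
Proof.
move=> fs; apply: (jet_poly _ _ ('X^k * Poly s)); last first.
  move=> i _; rewrite coefXnM coef_Poly nth_cat size_nseq nth_nseq.
  by case: ifP => // ->.
apply: eq_flat (flatM _ _ _ _ (flat_exprn k) fs); near=> t.
by rewrite hornerM hornerXn; ring.
Unshelve. all: by end_near. Qed.

Lemma jet_div n k f s : jet (n + k) f (nseq k 0 ++ s) ->
  jet n (fun t => f t / t ^+ k) s.
Proof.
move=> [M fM]; exists M; near=> t.
have t0 : t != 0 by near: t; exact: nbhs_dnbhs_neq.
have : `|f t - (Poly (nseq k 0 ++ s)).[t]| <= M * `|t| ^+ (n + k) by near: t.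
have -> : Poly (nseq k 0 ++ s) = 'X^k * Poly s.
  apply/polyP => i; rewrite coefXnM !coef_Poly nth_cat size_nseq nth_nseq.
  by case: ifP => // ->.
rewrite hornerM hornerXn.
have -> : f t - t ^+ k * (Poly s).[t] = (f t / t ^+ k - (Poly s).[t]) * t ^+ k.
  by field; rewrite expf_neq0.
rewrite normrM exprD mulrA -(normrX k) ler_pM2r// normr_gt0 expf_neq0//.
Unshelve. all: by end_near. Qed.

(** By induction on the order: the expansion of the derivative is integrated term by term. At order
    0 only boundedness near 0 is needed, which follows from continuity. *)
Lemma jet_taylor n f :
  (forall i, \forall t \near (0 : R), derivable (f^`(i))%classic (t : R) (1 : R)) ->
  jet n f (mkseq (fun i => (f^`(i))%classic 0 / i`!%:R) n).
Proof.
elim: n f => [|n IH] f df.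
  apply: (jet_poly _ _ 0) => //; apply: (flatD 0).
    apply: flat_continuous; apply: (is_derive_continuous _ _ (f^`()%classic 0)).
    rewrite derive1E; apply: derivableP; exact: nbhs_singleton (df 0%N).
  rewrite (_ : (fun t : R => _) = fun=> 0); first exact: flat_cst.
  by apply/funext => t; rewrite horner0 oppr0.
apply: (jet_primitive _ _ (f^`()%classic)).
- by apply: filterS (df 0%N) => t ft; rewrite derive1E; exact: derivableP.
- by apply: IH => i; apply: filterS (df i.+1) => t; rewrite derive1Sn.
- by rewrite nth_mkseq// fact0 divr1.
- move=> i ni; rewrite !nth_mkseq// -derive1Sn factS natrM -[RHS]mulr_natr.
  by rewrite invfM [_^-1 * _^-1]mulrC mulrA divfK ?pnatr_eq0.
Qed.

End jets.

(** Treats the indices one at a time: those not below the order are refuted by computation, the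
    others leave a field identity. Eight cases are enough, as no order above 6 occurs. *)
Ltac coefs := let i := fresh "i" in let h := fresh "h" in move=> i;
  do 8? [case: i => [|i]; first by move=> h; first [case: (notF h)
    | rewrite ?big_ord_recl ?big_ord0 /=; field]];
  by rewrite ?ltnS ?ltn0.

(** * Expansions of the errors in the lower and upper bounds *)

Section expansions.
Context {R : realType}.

Lemma jet_id n : jet n (fun t : R => t) [:: 0; 1].
Proof.
apply: eq_jet (jet_Poly n [:: 0; 1]) => //.
by near=> t; rewrite horner_Poly /= mul0r add0r mul1r addr0.
Unshelve. all: by end_near. Qed.

Lemma jet_cst n (c : R) : jet n (fun=> c) [:: c].
Proof.
apply: eq_jet (jet_Poly n [:: c]) => //.
by near=> t; rewrite horner_Poly /= mul0r add0r.
Unshelve. all: by end_near. Qed.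

Lemma jetT n (f g : R -> R) s : jet n f s -> (forall t, f t = g t) -> jet n g s.
Proof. by move=> fs /funext <-. Qed.

(* [t^2 V t] and [t^3 W t] will be the squared length of the chord from the base
   point and the area enclosed by it. *)
Section defects.
Context (V W : R -> R) (h k m : R)
  (jV : jet 5 V [:: 1; 0; - h ^+ 2 / 12; - h * k / 12;
    - h ^+ 4 / 45 - k ^+ 2 / 45 - h * m / 40])
  (jW : jet 3 W [:: h / 12; k / 24; m / 80 + h ^+ 3 / 120]).

Let jW2 : jet 5 (fun t => t ^+ 2 * W t)
  [:: 0; 0; h / 12; k / 24; m / 80 + h ^+ 3 / 120].
Proof. exact: (jet_shift _ 2 _ _ jW). Qed.

(** The expression is [P / t^2] times the excess of the calibration bound over
    [t^2 - k^2 t^6 / 720]. The contributions of [m] from the chord and from the area cancel, and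
    those of [k ^+ 2] leave exactly the coefficient 1/720. *)
Lemma lower_defect_flat :
  let lam t := h * t + k / 2 * t ^+ 2 in
  let P t := 4 * phase (lam t) 2^-1 in
  flat 5 (fun t => 2 * P t * (h + k / 2 * t) * (t ^+ 2 * W t)
    + V t * (1 - (P t * lam t) ^+ 2 / 16)
    - P t * (1 - k ^+ 2 / 720 * t ^+ 4)).
Proof.
move=> lam P; apply: jet_flat.
have jt := jet_id 5; have j1 := jet_cst 5 1.
have jh : jet 5 (fun t => h * 1 + k / 2 * t) [:: h; k / 2].
  by apply: (jet_lin _ _ _ _ _ _ _ _ j1 jt); coefs.
have jl : jet 5 lam [:: 0; h; k / 2].
  apply: (jetT _ (fun t => t * (h * 1 + k / 2 * t))).
    by apply: (jetM _ _ _ _ _ _ jt jh); coefs.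
  by move=> t; rewrite /lam; ring.
have jl2 : jet 5 (fun t => lam t * lam t) [:: 0; 0; h ^+ 2; h * k; k ^+ 2 / 4].
  by apply: (jetM _ _ _ _ _ _ jl jl); coefs.
have jl4 := jetM _ _ _ _ _ [:: 0; 0; 0; 0; h ^+ 4] jl2 jl2.
have {}jl4 : jet 5 _ _ := jl4 ltac:(coefs).
have jl6 := jetM _ _ _ _ _ [::] jl2 jl4.
have {}jl6 : jet 5 _ _ := jl6 ltac:(coefs).
have jP1 := jet_lin _ _ _ _ _
  [:: 1; 0; h ^+ 2 / 48; h * k / 48; k ^+ 2 / 192]
  1 (48^-1) j1 jl2.
have {}jP1 := jP1 ltac:(coefs).
have jP2 := jet_lin _ _ _ _ _
  [:: 1; 0; h ^+ 2 / 48; h * k / 48; k ^+ 2 / 192 + h ^+ 4 / 1920]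
  1 (1920^-1) jP1 jl4.
have {}jP2 := jP2 ltac:(coefs).
have jP3 := jet_lin _ _ _ _ _
  [:: 1; 0; h ^+ 2 / 48; h * k / 48; k ^+ 2 / 192 + h ^+ 4 / 1920]
  1 (4096^-1) jP2 jl6.
have {}jP3 := jP3 ltac:(coefs).
have jP : jet 5 P [:: 1; 0; h ^+ 2 / 48; h * k / 48; k ^+ 2 / 192 + h ^+ 4 / 1920].
  by apply: (jetT _ _ _ _ jP3) => t; rewrite /P /phase; field.
have jPl := jetM _ _ _ _ _
  [:: 0; h; k / 2; h ^+ 3 / 48; h ^+ 2 * k / 32]
  jP jl.
have {}jPl := jPl ltac:(coefs).
have jPl2 := jetM _ _ _ _ _
  [:: 0; 0; h ^+ 2; h * k; k ^+ 2 / 4 + h ^+ 4 / 24]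
  jPl jPl.
have {}jPl2 := jPl2 ltac:(coefs).
have jd := jet_lin _ _ _ _ _
  [:: 1; 0; - h ^+ 2 / 16; - h * k / 16; - k ^+ 2 / 64 - h ^+ 4 / 384]
  1 (- 16^-1) j1 jPl2.
have {}jd := jd ltac:(coefs).
have jt2 := jetM _ _ _ _ _ [:: 0; 0; 1] jt jt.
have {}jt2 : jet 5 _ _ := jt2 ltac:(coefs).
have jt4 := jetM _ _ _ _ _ [:: 0; 0; 0; 0; 1] jt2 jt2.
have {}jt4 : jet 5 _ _ := jt4 ltac:(coefs).
have je := jet_lin _ _ _ _ _
  [:: 1; 0; 0; 0; - k ^+ 2 / 720]
  1 (- (k ^+ 2 / 720)) j1 jt4.
have {}je := je ltac:(coefs).
have a1 := jetM _ _ _ _ _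
  [:: 0; 0; h ^+ 2 / 12; h * k / 12; h * m / 80 + h ^+ 4 / 120 + k ^+ 2 / 48]
  jh jW2.
have {}a1 := a1 ltac:(coefs).
have a2 := jetM _ _ _ _ _
  [:: 0; 0; h ^+ 2 / 12; h * k / 12;
    h * m / 80 + h ^+ 4 / 120 + k ^+ 2 / 48 + h ^+ 4 / 576]
  jP a1.
have {}a2 := a2 ltac:(coefs).
have b := jetM _ _ _ _ _ [:: 1; 0; - h ^+ 2 * 7 / 48; - h * k * 7 / 48;
  - h ^+ 4 / 45 - k ^+ 2 / 45 - h * m / 40 + h ^+ 4 / 192 - k ^+ 2 / 64
    - h ^+ 4 / 384] jV jd.
have {}b := b ltac:(coefs).
have c := jetM _ _ _ _ _ [:: 1; 0; h ^+ 2 / 48; h * k / 48;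
  k ^+ 2 / 192 + h ^+ 4 / 1920 - k ^+ 2 / 720] jP je.
have {}c := c ltac:(coefs).
have ab := jet_lin _ _ _ _ _ [:: 1; 0; h ^+ 2 / 48; h * k / 48;
  k ^+ 2 / 192 + h ^+ 4 / 1920 - k ^+ 2 / 720] 2 1 a2 b.
have {}ab := ab ltac:(coefs).
have abc := jet_lin _ _ _ _ _ [::] 1 (-1) ab c.
have {}abc := abc ltac:(coefs).
by apply: (jetT _ _ _ _ abc) => t; field.
Qed.

(** The expression is [V D^2 / t^2] times the excess of the energy of the polynomial curve with
    [n = h^2 t^2 / 2]; then [n / 30] and [n^2 / 180] give the denominators 60 and 720. *)
Lemma upper_defect_flat :
  let D t := 1 + h ^+ 2 * t ^+ 2 / 60 in
  flat 5 (fun t => (V t * D t) ^+ 2 * (1 + h ^+ 4 * t ^+ 4 / 720)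
    + 12 * t ^+ 2 * W t ^+ 2 - V t * D t ^+ 2 * (1 - k ^+ 2 / 720 * t ^+ 4)).
Proof.
move=> D; apply: jet_flat.
have jt := jet_id 5; have j1 := jet_cst 5 1.
have jt2 := jetM _ _ _ _ _ [:: 0; 0; 1] jt jt.
have {}jt2 : jet 5 _ _ := jt2 ltac:(coefs).
have jt4 := jetM _ _ _ _ _ [:: 0; 0; 0; 0; 1] jt2 jt2.
have {}jt4 : jet 5 _ _ := jt4 ltac:(coefs).
have jD := jet_lin _ _ _ _ _ [:: 1; 0; h ^+ 2 / 60] 1 (h ^+ 2 / 60) j1 jt2.
have {}jD := jD ltac:(coefs).
have je := jet_lin _ _ _ _ _
  [:: 1; 0; 0; 0; - k ^+ 2 / 720]
  1 (- (k ^+ 2 / 720)) j1 jt4.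
have {}je := je ltac:(coefs).
have jg := jet_lin _ _ _ _ _
  [:: 1; 0; 0; 0; h ^+ 4 / 720]
  1 (h ^+ 4 / 720) j1 jt4.
have {}jg := jg ltac:(coefs).
pose e := - h ^+ 4 / 45 - k ^+ 2 / 45 - h * m / 40.
have jVD := jetM _ _ _ _ _
  [:: 1; 0; - h ^+ 2 / 15; - h * k / 12; e - h ^+ 4 / 720]
  jV jD.
have {}jVD := jVD ltac:(rewrite /e; coefs).
have jVD2 := jetM _ _ _ _ _ [:: 1; 0; - h ^+ 2 * 2 / 15; - h * k / 6;
  2 * e - h ^+ 4 / 360 + h ^+ 4 / 225] jVD jVD.
have {}jVD2 := jVD2 ltac:(rewrite /e; coefs).
have a := jetM _ _ _ _ _ [:: 1; 0; - h ^+ 2 * 2 / 15; - h * k / 6;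
  2 * e - h ^+ 4 / 360 + h ^+ 4 / 225 + h ^+ 4 / 720] jVD2 jg.
have {}a := a ltac:(rewrite /e; coefs).
have jWW := jetM _ _ _ _ _ [:: h ^+ 2 / 144; h * k / 144;
  k ^+ 2 / 576 + h * (m / 80 + h ^+ 3 / 120) / 6] jW jW.
have {}jWW := jet_shift _ 2 _ _ (jWW ltac:(coefs)).
have ab := jet_lin _ _ _ _ _ [:: 1; 0; - h ^+ 2 / 20; - h * k / 12;
  2 * e - h ^+ 4 / 360 + h ^+ 4 / 225 + h ^+ 4 / 720 +
  k ^+ 2 / 48 + h * (m / 80 + h ^+ 3 / 120) * 2] 1 12 a jWW.
have {}ab := ab ltac:(rewrite /e; coefs).
have c1 := jetM _ _ _ _ _ [:: 1; 0; - h ^+ 2 / 20; - h * k / 12;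
  e - h ^+ 4 / 720 - h ^+ 4 / 900] jVD jD.
have {}c1 := c1 ltac:(rewrite /e; coefs).
have c := jetM _ _ _ _ _ [:: 1; 0; - h ^+ 2 / 20; - h * k / 12;
  e - h ^+ 4 / 720 - h ^+ 4 / 900 - k ^+ 2 / 720] c1 je.
have {}c := c ltac:(rewrite /e; coefs).
have abc := jet_lin _ _ _ _ _ [::] 1 (-1) ab c.
have {}abc := abc ltac:(rewrite /e; coefs).
by apply: (jetT _ _ _ _ abc) => t; rewrite /D; field.
Qed.
End defects.

End expansions.

(** * Iterated derivatives of coordinates and the unit speed relations *)

Section smooth_curves.
Context {R : realType}.

Lemma near_open (U : set R) (P : R -> Prop) (t : R) : open U -> U t ->
  (forall s, U s -> P s) -> \forall s \near t, P s.
Proof.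
by move=> oU Ut UP; apply: filterS (open_nbhs_nbhs (conj oU Ut)) => s /UP.
Qed.

(** The two claims are proved together: the identity of the [n]th derivatives is known only on [U],
    and openness of [U] is what allows it to be differentiated once more. *)
Lemma is_derive_derive1n_fst (V W : normedModType R) (f : R -> V * W) (U : set R) :
  open U -> (forall n t, U t -> derivable (derive1n n f) t 1) ->
  forall n t, U t ->
  derive1n n (fun s => (f s).1) t = (derive1n n f t).1 /\
  is_derive t 1 (derive1n n (fun s => (f s).1)) (derive1n n.+1 f t).1.
Proof.
move=> oU df; elim=> [|n IH] t Ut.
  split=> //; apply: is_derive_fst; rewrite derive1nS derive1E.
  exact/derivableP/(df 0%N).
have h s : U s -> derive1n n.+1 (fun r => (f r).1) s = (derive1n n.+1 f s).1.
  by move=> Us; rewrite derive1nS derive1E; have [_ d] := IH _ Us; exact: derive_val.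
split; first exact: h.
apply: (@near_eq_is_derive _ _ _ (fun s => (derive1n n.+1 f s).1)) => //.
- by apply: (near_open U) => // s Us; rewrite h.
- apply: is_derive_fst; rewrite (derive1nS _ n.+1) derive1E.
  exact/derivableP/df.
Qed.

Lemma is_derive_derive1n_snd (V W : normedModType R) (f : R -> V * W) (U : set R) :
  open U -> (forall n t, U t -> derivable (derive1n n f) t 1) ->
  forall n t, U t ->
  derive1n n (fun s => (f s).2) t = (derive1n n f t).2 /\
  is_derive t 1 (derive1n n (fun s => (f s).2)) (derive1n n.+1 f t).2.
Proof.
move=> oU df; elim=> [|n IH] t Ut.
  split=> //; apply: is_derive_snd; rewrite derive1nS derive1E.
  exact/derivableP/(df 0%N).
have h s : U s -> derive1n n.+1 (fun r => (f r).2) s = (derive1n n.+1 f s).2.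
  by move=> Us; rewrite derive1nS derive1E; have [_ d] := IH _ Us; exact: derive_val.
split; first exact: h.
apply: (@near_eq_is_derive _ _ _ (fun s => (derive1n n.+1 f s).2)) => //.
- by apply: (near_open U) => // s Us; rewrite h.
- apply: is_derive_snd; rewrite (derive1nS _ n.+1) derive1E.
  exact/derivableP/df.
Qed.

Lemma derive_cst_on (U : set R) (g g' : R -> R) (c : R) : open U ->
  (forall t, U t -> g t = c) ->
  (forall t : R, U t -> is_derive t 1 g (g' t)) -> forall t, U t -> g' t = 0.
Proof.
move=> oU gc dg t Ut; have d := dg t Ut.
have d0 : is_derive t 1 g 0.
  apply: (@near_eq_is_derive _ _ _ (cst c)) => //.
  by apply: (near_open U) => // s /gc ->.
by rewrite -(@derive_val _ _ _ _ _ _ _ d) (@derive_val _ _ _ _ _ _ _ d0).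
Qed.

(** Each relation is the derivative of the previous one, the first being halved. They determine the
    components along the velocity of the higher derivatives of a unit speed curve. *)
Lemma unit_speed_derivatives (U : set R) (x1 x2 x3 x4 x5 y1 y2 y3 y4 y5 : R -> R) :
  open U ->
  (forall t : R, U t -> [/\ is_derive t 1 x1 (x2 t), is_derive t 1 x2 (x3 t),
     is_derive t 1 x3 (x4 t) & is_derive t 1 x4 (x5 t)]) ->
  (forall t : R, U t -> [/\ is_derive t 1 y1 (y2 t), is_derive t 1 y2 (y3 t),
     is_derive t 1 y3 (y4 t) & is_derive t 1 y4 (y5 t)]) ->
  (forall t, U t -> x1 t ^+ 2 + y1 t ^+ 2 = 1) ->
  forall t, U t ->
  [/\ x1 t * x2 t + y1 t * y2 t = 0,
      x2 t ^+ 2 + y2 t ^+ 2 + x1 t * x3 t + y1 t * y3 t = 0,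
      3 * (x2 t * x3 t + y2 t * y3 t) + x1 t * x4 t + y1 t * y4 t = 0
    & 3 * (x3 t ^+ 2 + y3 t ^+ 2) + 4 * (x2 t * x4 t + y2 t * y4 t)
      + x1 t * x5 t + y1 t * y5 t = 0].
Proof.
move=> oU dx dy e0.
have e1 t : U t -> x1 t * x2 t + y1 t * y2 t = 0.
  move=> Ut; apply: (mulfI (x := 2)); first by rewrite pnatr_eq0.
  rewrite mulr0; move: t Ut; apply: (derive_cst_on U _ _ _ oU e0) => t Ut.
  have [? ? ? ?] := dx _ Ut; have [? ? ? ?] := dy _ Ut.
  by apply: is_derive_eq; rewrite /GRing.scale/=; ring.
have e2 t : U t -> x2 t ^+ 2 + y2 t ^+ 2 + x1 t * x3 t + y1 t * y3 t = 0.
  move: t; apply: (derive_cst_on U _ _ _ oU e1) => t Ut.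
  have [? ? ? ?] := dx _ Ut; have [? ? ? ?] := dy _ Ut.
  by apply: is_derive_eq; rewrite /GRing.scale/=; ring.
have e3 t : U t -> 3 * (x2 t * x3 t + y2 t * y3 t) + x1 t * x4 t + y1 t * y4 t = 0.
  move: t; apply: (derive_cst_on U _ _ _ oU e2) => t Ut.
  have [? ? ? ?] := dx _ Ut; have [? ? ? ?] := dy _ Ut.
  by apply: is_derive_eq; rewrite /GRing.scale/=; ring.
have e4 t : U t -> 3 * (x3 t ^+ 2 + y3 t ^+ 2) + 4 * (x2 t * x4 t + y2 t * y4 t)
    + x1 t * x5 t + y1 t * y5 t = 0.
  move: t; apply: (derive_cst_on U _ _ _ oU e3) => t Ut.
  have [? ? ? ?] := dx _ Ut; have [? ? ? ?] := dy _ Ut.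
  by apply: is_derive_eq; rewrite /GRing.scale/=; ring.
by move=> t Ut; split; [exact: e1|exact: e2|exact: e3|exact: e4].
Qed.

(** The two terms [x2 t * y2 t] cancel. With [x1] and [y1] the velocity components, this computes
    the geodesic curvature. *)
Lemma is_derive_wronskian (x1 x2 x3 y1 y2 y3 : R -> R) (t : R) :
  is_derive t 1 x1 (x2 t) -> is_derive t 1 x2 (x3 t) ->
  is_derive t 1 y1 (y2 t) -> is_derive t 1 y2 (y3 t) ->
  is_derive t 1 (fun s => x1 s * y2 s - y1 s * x2 s)
    (x1 t * y3 t - y1 t * x3 t).
Proof. by move=> *; apply: is_derive_eq; rewrite /GRing.scale/=; ring. Qed.

End smooth_curves.

(** * Two-sided bounds of the distance in terms of chord and area *)

Section distance_bounds.
Context {R : realType}.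

Lemma phase_ge (lam : R) : 4^-1 <= phase lam 2^-1.
Proof.
rewrite (_ : phase _ _ =
  4^-1 + (lam ^+ 2 / 192 + lam ^+ 4 / 7680 + lam ^+ 6 / 16384)).
  rewrite lerDl; repeat apply: addr_ge0; apply: divr_ge0; try exact: ler0n;
    by apply: exprn_even_ge0.
by rewrite /phase; field.
Qed.

(** The calibration bound is a concave quadratic function of [(B1, B2)]; the right-hand side is the
    square root of its maximum. *)
Lemma heis_dist_ge (A B : heis R) (lam x y z c P : R) :
  x = xc B - xc A -> y = yc B - yc A ->
  z = B.2 - A.2 - (xc A * y - yc A * x) / 2 ->
  c = x ^+ 2 + y ^+ 2 -> P = 4 * phase lam 2^-1 -> 0 < c -> `|lam| <= 1 ->
  ((Num.sqrt (2 * lam * z + c * (1 - (P * lam) ^+ 2 / 16) / P))%:E <=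
   heis_dist A B)%E.
Proof.
move=> xE yE zE cE PE c0 lam1.
set M := 2 * lam * z + _.
apply: le_ereal_inf_tmp => _ [a [b [gamma [u [ab hc gA gB ->]]]]].
have [M0|M0] := leP M 0.
  by rewrite ler0_sqrtr//; apply: integral_ge0 => t _; rewrite lee_fin hnorm_ge0.
case: (ltgtP a b) ab => // ab _; last first.
  (* A curve on a single point would have zero chord, against [0 < c]. *)
  exfalso; move: c0; rewrite cE xE yE -gA -gB ab !subrr expr0n addr0 ltxx//.
rewrite leNgt; apply/negP => lM.
have l0 : (0%:E <= hlength a b u)%E.
  by apply: integral_ge0 => t _; rewrite lee_fin hnorm_ge0.
have lfin : hlength a b u \is a fin_num.
  by rewrite ge0_fin_numE// (lt_trans lM)// ltry.
move: lM l0; rewrite -(fineK lfin) lte_fin lee_fin; set l := fine _ => lM l0.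
(* A value strictly between the length and [Num.sqrt M] is positive even if the length is 0, and its
   square is below [M]. *)
pose L := (l + Num.sqrt M) / 2.
have [lL LM] : l < L /\ L < Num.sqrt M by rewrite /L; split; lra.
have L0 : 0 < L by apply: le_lt_trans lL.
have P0 : 0 < P.
  by rewrite PE mulr_gt0// (lt_le_trans _ (phase_ge _))// invr_gt0.
(* [B1] and [B2] are the critical point of the quadratic function. *)
pose B1 := 2 * (x + P * lam * y / 4) / P.
pose B2 := 2 * (y - P * lam * x / 4) / P.
have lL' : (hlength a b u <= L%:E)%E by rewrite -(fineK lfin) lee_fin ltW.
have xE' : x = xc (gamma b) - xc (gamma a) by rewrite gA gB.
have yE' : y = yc (gamma b) - yc (gamma a) by rewrite gA gB.
have zE' : z = (gamma b).2 - (gamma a).2 - (xc (gamma a) * y - yc (gamma a) * x) / 2.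
  by rewrite gA gB.
have := heis_length_ge a b gamma u lam L B1 B2 x y z ab hc lL' L0 lam1 xE' yE' zE'.
have -> : phase lam 2^-1 = P / 4 by rewrite PE; field.
have -> : 2 * lam * z + B1 * x + B2 * y - P / 4 / 2 *
    ((lam * x + B2) ^+ 2 + (lam * y - B1) ^+ 2 + B1 ^+ 2 + B2 ^+ 2) = M.
  by rewrite /M /B1 /B2 cE; field; rewrite gt_eqF.
apply/negP; rewrite -ltNge -[ltRHS]sqr_sqrtr ?ltW//.
by rewrite ltrXn2r ?nnegrE ?sqrtr_ge0 ?ltW.
Qed.

(** The area [z] forces the value of [m], since [m / 12 + m n / 360 = m (1 + n / 30) / 12]. Taking
    for [e] the square root of the energy [E] turns [(E / e + e) / 2] into [Num.sqrt E]. *)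
Lemma heis_dist_chord_area_le (A B : heis R) (n x y z c : R) :
  x = xc B - xc A -> y = yc B - yc A ->
  z = B.2 - A.2 - (xc A * y - yc A * x) / 2 ->
  c = x ^+ 2 + y ^+ 2 -> 0 < c -> 0 <= n ->
  (heis_dist A B <= (Num.sqrt (c * (1 + n ^+ 2 / 180)
     + 12 * z ^+ 2 / (c * (1 + n / 30) ^+ 2)))%:E)%E.
Proof.
move=> xE yE zE cE c0 n0.
pose D := 1 + n / 30.
have D0 : 0 < D by rewrite ltr_wpDr// divr_ge0.
have [c_neq0 D_neq0] : c != 0 /\ D != 0 by rewrite !gt_eqF.
pose m := 12 * z / (c * D).
have mE : c * (m / 12 + m * n / 360) = z.
  have -> : m / 12 + m * n / 360 = m * D / 12 by rewrite /D; field.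
  by rewrite /m; clearbody D; field; rewrite c_neq0 D_neq0.
have BE : B = (xc A + x, yc A + y,
    A.2 + (xc A * y - yc A * x) / 2 + c * (m / 12 + m * n / 360)).
  rewrite mE [LHS]surjective_pairing [B.1]surjective_pairing.
  by congr (_, _, _); rewrite ?zE ?xE ?yE /xc /yc; ring.
rewrite -/D; set E := c * _ + _.
have EE : E = c * (1 + m ^+ 2 / 12 + n ^+ 2 / 180).
  by rewrite /E /m; clearbody D; field; rewrite c_neq0 D_neq0.
have E0 : 0 < E.
  rewrite EE; apply: mulr_gt0 => //; rewrite -addrA; apply: ltr_pwDl => //.
  by apply: addr_ge0; (apply: divr_ge0; [exact: sqr_ge0|exact: ler0n]).
have sE : 0 < Num.sqrt E by rewrite sqrtr_gt0.
have := heis_dist_le A B x y c m n _ sE cE BE.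
have EsE : E / Num.sqrt E = Num.sqrt E.
  by rewrite -{1}(sqr_sqrtr (ltW E0)) expr2 mulfK ?gt_eqF.
rewrite -EE EsE.
by have -> : (Num.sqrt E + Num.sqrt E) / 2 = Num.sqrt E by field.
Qed.

(** For a zero chord the energy bound reduces to half of an arbitrary positive number. The equality
    settles the base point in the final estimate. *)
Lemma heis_dist_refl (A : heis R) : heis_dist A A = 0%E.
Proof.
apply/eqP; rewrite eq_le; apply/andP; split; last first.
  apply: le_ereal_inf_tmp => _ [a [b [gamma [u [_ _ _ _ ->]]]]].
  by apply: integral_ge0 => t _; rewrite lee_fin hnorm_ge0.
apply/lee_addgt0Pr => e e0; rewrite add0e.
have := heis_dist_le A A 0 0 0 0 0 (2 * e).
rewrite !(mul0r, addr0, mulr0, expr0n, add0r, subr0)/=.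
move=> /(_ (mulr_gt0 (ltr0Sn _ _) e0) (erefl _)).
rewrite (_ : 2 * e / 2 = e); last by field.
by apply; rewrite oppr0 mul0r addr0; case: (A) => -[].
Qed.

(** The upper bound makes the distance finite, so both bounds can be squared as real inequalities; a
    nonpositive left-hand side is below any square. *)
Lemma heis_dist_sqr_bounds (A B : heis R) (lam n x y z c P : R) :
  x = xc B - xc A -> y = yc B - yc A ->
  z = B.2 - A.2 - (xc A * y - yc A * x) / 2 ->
  c = x ^+ 2 + y ^+ 2 -> P = 4 * phase lam 2^-1 -> 0 < c -> `|lam| <= 1 ->
  0 <= n ->
  2 * lam * z + c * (1 - (P * lam) ^+ 2 / 16) / P
    <= fine (heis_dist A B) ^+ 2 <=
  c * (1 + n ^+ 2 / 180) + 12 * z ^+ 2 / (c * (1 + n / 30) ^+ 2).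
Proof.
move=> xE yE zE cE PE c0 lam1 n0.
have := heis_dist_ge _ _ lam _ _ _ _ _ xE yE zE cE PE c0 lam1.
have := heis_dist_chord_area_le _ _ n _ _ _ _ xE yE zE cE c0 n0.
set M := 2 * lam * z + _; set E := c * _ + _ => dE dM.
have d0 := le_trans (_ : (0 <= (Num.sqrt M)%:E)%E) dM.
have {}d0 : (0 <= heis_dist A B)%E by apply: d0; rewrite lee_fin sqrtr_ge0.
have dfin : heis_dist A B \is a fin_num.
  by rewrite ge0_fin_numE// (le_lt_trans dE)// ltry.
move: dE dM d0; rewrite -(fineK dfin) !lee_fin; set d := fine _ => dE dM d0.
have E0 : 0 <= E.
  rewrite /E; apply: addr_ge0.
    apply: mulr_ge0; first exact: ltW.
    by apply: addr_ge0 => //; apply: divr_ge0; [exact: sqr_ge0|exact: ler0n].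
  apply: divr_ge0; first by rewrite mulr_ge0// sqr_ge0.
  by apply: mulr_ge0; [exact: ltW|exact: sqr_ge0].
apply/andP; split; last first.
  by rewrite -[leRHS](sqr_sqrtr E0) lerXn2r ?nnegrE ?sqrtr_ge0.
have [M0|M0] := leP M 0; first by rewrite (le_trans M0)// sqr_ge0.
by rewrite -[leLHS](sqr_sqrtr (ltW M0)) lerXn2r ?nnegrE ?sqrtr_ge0.
Qed.

End distance_bounds.

(** * Taylor expansions of the squared chord and of the enclosed area *)

Section chord_area.
Context {R : realType}.

Lemma jet_taylor6 (f : R -> R) (U : set R) : open U -> U 0 ->
  (forall n t, U t -> derivable (derive1n n f) t 1) ->
  jet 6 (fun t => f t - f 0) [:: 0; derive1n 1 f 0; derive1n 2 f 0 / 2;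
    derive1n 3 f 0 / 6; derive1n 4 f 0 / 24; derive1n 5 f 0 / 120] /\
  jet 5 (derive1n 1 f) [:: derive1n 1 f 0; derive1n 2 f 0; derive1n 3 f 0 / 2;
    derive1n 4 f 0 / 6; derive1n 5 f 0 / 24].
Proof.
move=> oU U0 df.
have E : (((1`! = 1) * (2`! = 2)) *
  ((3`! = 6) * ((4`! = 24) * (5`! = 120))))%type by [].
split.
- have jf : jet 6 f _ := jet_taylor 6 f (fun i => near_open U _ _ oU U0 (df i)).
  apply: (jetT 6 (fun t => 1 * f t + - f 0 * 1)).
    apply: (jet_lin _ _ _ _ _ _ _ _ jf (jet_cst 6 1)).
    by do 6! [case=> [|]; first by move=> _; rewrite /= ?E ?fact0; field].
  by move=> t; ring.
- have df' i t : U t -> derivable (derive1n i (derive1 f)) t 1.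
    by rewrite -derive1Sn; exact: df.
  apply: eq_jet (jet_taylor 5 _ (fun i => near_open U _ _ oU U0 (df' i))).
    exact: nearW.
  by do 5! [case=> [|]; first by move=> _; rewrite /= ?E ?fact0; field].
Qed.

(** In the orthonormal frame given by the initial velocity [(a, b)] and its normal [(- b, a)], the
    normal components of the second, third and fourth derivatives are [h], [k] and [m]. The unit
    speed relations express the tangential components through these three numbers. *)
Lemma chord_area_jets (x y z : R -> R) (U : set R) (h k : R) :
  open U -> U 0 ->
  (forall n t, U t -> is_derive t 1 (derive1n n x) (derive1n n.+1 x t)) ->
  (forall n t, U t -> is_derive t 1 (derive1n n y) (derive1n n.+1 y t)) ->
  (forall t, U t -> is_derive t 1 z
    ((x t * derive1n 1 y t - y t * derive1n 1 x t) / 2)) ->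
  (forall t, U t -> derive1n 1 x t ^+ 2 + derive1n 1 y t ^+ 2 = 1) ->
  h = derive1n 1 x 0 * derive1n 2 y 0 - derive1n 1 y 0 * derive1n 2 x 0 ->
  k = derive1n 1 x 0 * derive1n 3 y 0 - derive1n 1 y 0 * derive1n 3 x 0 ->
  exists m : R,
    jet 5 (fun t => ((x t - x 0) ^+ 2 + (y t - y 0) ^+ 2) / t ^+ 2)
      [:: 1; 0; - h ^+ 2 / 12; - h * k / 12;
        - h ^+ 4 / 45 - k ^+ 2 / 45 - h * m / 40] /\
    jet 3 (fun t => (z t - z 0 - (x 0 * (y t - y 0) - y 0 * (x t - x 0)) / 2)
        / t ^+ 3)
      [:: h / 12; k / 24; m / 80 + h ^+ 3 / 120].
Proof.
move=> oU U0 dx dy dz e0 hE kE.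
have [jx jx'] := jet_taylor6 x U oU U0
  (fun n t Ut => ex_derive (is_derive := dx n t Ut)).
have [jy jy'] := jet_taylor6 y U oU U0
  (fun n t Ut => ex_derive (is_derive := dy n t Ut)).
have [||e1 e2 e3 e4] := unit_speed_derivatives U (derive1n 1 x) (derive1n 2 x)
  (derive1n 3 x) (derive1n 4 x) (derive1n 5 x) (derive1n 1 y) (derive1n 2 y)
  (derive1n 3 y) (derive1n 4 y) (derive1n 5 y) oU _ _ e0 0 U0.
- by move=> t Ut; split; exact: dx.
- by move=> t Ut; split; exact: dy.
have {}e0 := e0 0 U0.
move: jx jx' jy jy' e0 e1 e2 e3 e4 hE kE.
set a := derive1n 1 x 0; set b := derive1n 1 y 0.
move: (derive1n 2 x 0) (derive1n 3 x 0) (derive1n 4 x 0) (derive1n 5 x 0)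
  (derive1n 2 y 0) (derive1n 3 y 0) (derive1n 4 y 0) (derive1n 5 y 0)
  => x2 x3 x4 x5 y2 y3 y4 y5 jx jx' jy jy' e0 e1 e2 e3 e4 hE kE.
pose m := a * y4 - b * x4; pose q := a * y5 - b * x5.
(* For this and the next two identities, scalar products of derivatives are decomposed in the frame;
   the second derivative has no tangential component by [e1]. *)
have C3 : a * x3 + b * y3 = - h ^+ 2.
  rewrite hE; have : (a * y2 - b * x2) ^+ 2 =
    (a ^+ 2 + b ^+ 2) * (x2 ^+ 2 + y2 ^+ 2) - (a * x2 + b * y2) ^+ 2 by ring.
  by rewrite e0 e1 => ->; lra.
have C4 : a * x4 + b * y4 = - 3 * h * k.
  have : (a ^+ 2 + b ^+ 2) * (x2 * x3 + y2 * y3) =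
    (a * x2 + b * y2) * (a * x3 + b * y3) + h * k by rewrite hE kE; ring.
  by rewrite e0 e1 => h1; lra.
have C5 : a * x5 + b * y5 = - 3 * h ^+ 4 - 3 * k ^+ 2 - 4 * h * m.
  have h1 : (a ^+ 2 + b ^+ 2) * (x3 ^+ 2 + y3 ^+ 2) =
    (a * x3 + b * y3) ^+ 2 + k ^+ 2 by rewrite kE; ring.
  have h2 : (a ^+ 2 + b ^+ 2) * (x2 * x4 + y2 * y4) =
    (a * x2 + b * y2) * (a * x4 + b * y4) + h * m by rewrite hE /m; ring.
  move: h1 h2; rewrite e0 e1 C3 mul0r => h1 h2.
  have h3 : (- h ^+ 2) ^+ 2 = h ^+ 4 by ring.
  by rewrite h3 in h1; lra.
pose X t := a * (x t - x 0) + b * (y t - y 0).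
pose Y t := (- b) * (x t - x 0) + a * (y t - y 0).
pose X' t := a * derive1n 1 x t + b * derive1n 1 y t.
pose Y' t := (- b) * derive1n 1 x t + a * derive1n 1 y t.
pose c5 := - 3 * h ^+ 4 - 3 * k ^+ 2 - 4 * h * m.
have jX : jet 6 X [:: 0; 1; 0; - h ^+ 2 / 6; - h * k / 8; c5 / 120].
  apply: (jet_lin _ _ _ _ _ _ _ _ jx jy); case=> [_|] /=; first by ring.
  case=> [_|]; first by rewrite /= -e0; ring.
  case=> [_|]; first by rewrite /= !mulrA -mulrDl e1 mul0r.
  case=> [_|]; first by rewrite /= !mulrA -mulrDl C3.
  case=> [_|]; first by rewrite /= !mulrA -mulrDl C4; field.
  case=> [_|]; first by rewrite /= !mulrA -mulrDl C5.
  by move=> i; rewrite !ltnS ltn0.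
have jY : jet 6 Y [:: 0; 0; h / 2; k / 6; m / 24; q / 120].
  by apply: (jet_lin _ _ _ _ _ _ _ _ jx jy); rewrite hE kE /m /q; coefs.
have jX' : jet 5 X' [:: 1; 0; - h ^+ 2 / 2; - h * k / 2; c5 / 24].
  apply: (jet_lin _ _ _ _ _ _ _ _ jx' jy').
  case=> [_|] /=; first by rewrite -e0; ring.
  case=> [_|]; first by rewrite /= e1.
  case=> [_|]; first by rewrite /= !mulrA -mulrDl C3.
  case=> [_|]; first by rewrite /= !mulrA -mulrDl C4; field.
  case=> [_|]; first by rewrite /= !mulrA -mulrDl C5.
  by move=> i; rewrite !ltnS ltn0.
have jY' : jet 5 Y' [:: 0; h; k / 2; m / 6; q / 24].
  by apply: (jet_lin _ _ _ _ _ _ _ _ jx' jy'); rewrite hE kE /m /q; coefs.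
exists m; split.
  have jX1 := jet_div 5 1 X [:: 1; 0; - h ^+ 2 / 6; - h * k / 8; c5 / 120] jX.
  have jY1 := jet_div 5 1 Y [:: 0; h / 2; k / 6; m / 24; q / 120] jY.
  have jXX := jetM _ _ _ _ _
    [:: 1; 0; - h ^+ 2 / 3; - h * k / 4; h ^+ 4 / 36 + c5 / 60] jX1 jX1.
  have {}jXX := jXX ltac:(coefs).
  have jYY := jetM _ _ _ _ _
    [:: 0; 0; h ^+ 2 / 4; h * k / 6; k ^+ 2 / 36 + h * m / 24] jY1 jY1.
  have {}jYY := jYY ltac:(coefs).
  have jV := jet_lin _ _ _ _ _ [:: 1; 0; - h ^+ 2 / 12; - h * k / 12;
        - h ^+ 4 / 45 - k ^+ 2 / 45 - h * m / 40] 1 1 jXX jYY.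
  have {}jV := jV ltac:(rewrite /c5; coefs).
  apply: (jetT _ _ _ _ jV) => t.
  (* At [t = 0] both sides are 0, because division by 0 gives 0. *)
  have [->|t0] := eqVneq t 0.
    by rewrite /X /Y !subrr !expr0n /= !invr0 !mulr0 !addr0.
  have XY : X t ^+ 2 + Y t ^+ 2 = (x t - x 0) ^+ 2 + (y t - y 0) ^+ 2.
    rewrite -[RHS]mul1r -e0 /X /Y; ring.
  by rewrite -XY; field.
have jX5 : jet 5 X [:: 0; 1; 0; - h ^+ 2 / 6; - h * k / 8; c5 / 120].
  exact: flatW jX.
have jY5 : jet 5 Y [:: 0; 0; h / 2; k / 6; m / 24; q / 120].
  exact: flatW jY.
have j1 := jetM _ _ _ _ _
    [:: 0; 0; h; k / 2; m / 6 - h ^+ 3 / 6] jX5 jY'.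
have {}j1 := j1 ltac:(coefs).
have j2 := jetM _ _ _ _ _
    [:: 0; 0; h / 2; k / 6; m / 24 - h ^+ 3 / 4] jY5 jX'.
have {}j2 := j2 ltac:(coefs).
have j3 := jet_lin _ _ _ _ _
    [:: 0; 0; h / 4; k / 6; m / 16 + h ^+ 3 / 24] (1 / 2) (- (1 / 2)) j1 j2.
have {}j3 := j3 ltac:(coefs).
(* The integrand is expanded to order 5, hence its primitive to order 6 and the quotient by [t ^+ 3]
   to order 3. *)
apply: jet_div; rewrite /=.
apply: (jet_primitive 5 _ _ _ _ _ j3).
- apply: (near_open U) => // t Ut.
  have dxt := dx 0%N t Ut; have dyt := dy 0%N t Ut; have dzt := dz t Ut.
  rewrite /= in dxt dyt.
  apply: is_derive_eq.
  rewrite /X /Y /X' /Y' /GRing.scale/=.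
  (* The change of frame has determinant [a ^+ 2 + b ^+ 2 = 1], so it preserves the area form. *)
  transitivity ((a ^+ 2 + b ^+ 2) / 2 * ((x t - x 0) * derive1 y t
    - (y t - y 0) * derive1 x t)); last by field.
  by rewrite e0; field.
- by rewrite /= !subrr !mulr0 subrr mul0r subr0.
- by coefs.
Qed.

End chord_area.

(** * Coordinates of a smooth curve, and smallness near 0 *)

Section components.
Context {R : realType}.

Lemma smooth_on_components (U : set R) (zeta : R -> heis R) : open U ->
  smooth_on U zeta -> forall n t, U t ->
  [/\ derive1n n (xc \o zeta) t = xc (derive1n n zeta t),
      derive1n n (yc \o zeta) t = yc (derive1n n zeta t),
      is_derive t 1 (derive1n n (xc \o zeta)) (derive1n n.+1 (xc \o zeta) t),
      is_derive t 1 (derive1n n (yc \o zeta)) (derive1n n.+1 (yc \o zeta) t)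
    & is_derive t 1 (fun s => (zeta s).2) (derive1 zeta t).2].
Proof.
move=> oU sz n t Ut.
pose f s := (zeta s).1.
have hf := is_derive_derive1n_fst _ _ zeta U oU sz.
have sf m s : U s -> derivable (derive1n m f) s 1.
  by move=> Us; have [_ d] := hf m s Us; apply: ex_derive.
have hx := is_derive_derive1n_fst _ _ f U oU sf.
have hy := is_derive_derive1n_snd _ _ f U oU sf.
have hz := is_derive_derive1n_snd _ _ zeta U oU sz.
split.
- by have [-> _] := hx n t Ut; have [-> _] := hf n t Ut.
- by have [-> _] := hy n t Ut; have [-> _] := hf n t Ut.
- by have [_ d] := hx n t Ut; have [-> _] := hx n.+1 t Ut.
- by have [_ d] := hy n t Ut; have [-> _] := hy n.+1 t Ut.
- by have [_ d] := hz 0%N t Ut.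
Qed.

Lemma flat1_small (f : R -> R) (e : R) : 0 < e -> flat 1 f ->
  \forall t \near 0^', `|f t| <= e.
Proof.
move=> e0 /flatP[M M0 fM]; near=> t.
have : `|f t| <= M * `|t| ^+ 1 by near: t.
move/le_trans; apply; rewrite expr1.
have : `|t| <= e / (M + 1).
  by near: t; apply: near0_ball; rewrite divr_gt0// ltr_wpDl.
rewrite ler_pdivlMr ?ltr_wpDl// => h; apply: le_trans h.
by rewrite mulrC ler_wpM2l// lerDl.
Unshelve. all: by end_near. Qed.

End components.

(** * The expansion of the squared distance along the curve *)

Theorem theorem1p2 (R : realType) (T : R) (zeta : R -> heis R)
    (T_gt0 : 0 < T)
    (zeta_smooth : smooth_on `]- T, T[ zeta)
    (zeta_horizontal : horizontal_on `]- T, T[ zeta)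
    (zeta_arclength : arclength_on `]- T, T[ zeta) :
  (fun t : R => fine (heis_dist (zeta 0) (zeta t)) ^+ 2) =
  (fun t : R => t ^+ 2 - geodesic_curvature zeta 0 ^+ 2 / 720 * t ^+ 6)
  +O_ (0 : R) (fun t : R => t ^+ 7).
Proof.
pose U : set R := `]- T, T[%classic.
have oU : open U by exact: interval_open.
have U0 : U 0 by rewrite /U /= in_itv/= oppr_lt0 T_gt0.
pose x := xc \o zeta; pose y := yc \o zeta; pose z t := (zeta t).2.
have comp := smooth_on_components U zeta oU zeta_smooth.
have dx n t : U t -> is_derive t 1 (derive1n n x) (derive1n n.+1 x t).
  by move=> Ut; have [_ _ d _ _] := comp n t Ut; exact: d.
have dy n t : U t -> is_derive t 1 (derive1n n y) (derive1n n.+1 y t).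
  by move=> Ut; have [_ _ _ d _] := comp n t Ut; exact: d.
have vel t : U t -> derive1n 1 x t ^+ 2 + derive1n 1 y t ^+ 2 = 1 /\
    is_derive t 1 z ((x t * derive1n 1 y t - y t * derive1n 1 x t) / 2).
  move=> Ut; have [u uE] := zeta_horizontal t Ut.
  have u1 := zeta_arclength t u Ut uE.
  have [hx hy _ _ _] := comp 1%N t Ut.
  have [_ _ _ _ hz] := comp 0%N t Ut.
  rewrite hx hy derive1n1 uE hvecE /xc /yc /=; split.
    by rewrite -hnorm_sqr u1 expr1n.
  by move: hz; rewrite uE hvecE.
pose h := derive1n 1 x 0 * derive1n 2 y 0 - derive1n 1 y 0 * derive1n 2 x 0.
pose k := derive1n 1 x 0 * derive1n 3 y 0 - derive1n 1 y 0 * derive1n 3 x 0.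
have kE : geodesic_curvature zeta 0 = k.
  rewrite /geodesic_curvature /char_deviation derive1E.
  have d := is_derive_wronskian _ _ _ _ _ _ 0 (dx 1%N 0 U0) (dx 2%N 0 U0)
    (dy 1%N 0 U0) (dy 2%N 0 U0).
  exact: (@derive_val _ _ _ _ _ _ _ d).
have [m [jV jW]] := chord_area_jets x y z U h k oU U0 dx dy
  (fun t Ut => (vel t Ut).2) (fun t Ut => (vel t Ut).1) erefl erefl.
pose qx t := x t - x 0; pose qy t := y t - y 0.
pose c t := qx t ^+ 2 + qy t ^+ 2.
pose zz t := z t - z 0 - (x 0 * qy t - y 0 * qx t) / 2.
pose V t := c t / t ^+ 2; pose W t := zz t / t ^+ 3.
have [M1 M10 lowM] := flatP _ _ (lower_defect_flat V W h k m jV jW).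
have [M2 M20 upM] := flatP _ _ (upper_defect_flat V W h k m jV jW).
have V1 : flat 1 (fun t => V t - 1).
  have jV1 : jet 1 V [:: 1; 0; - h ^+ 2 / 12; - h * k / 12;
      - h ^+ 4 / 45 - k ^+ 2 / 45 - h * m / 40] by exact: flatW jV.
  apply: (jet_flat 1 _).
  apply: (jetT _ (fun t => 1 * V t + -1 * 1)); last by move=> t; ring.
  apply: (jet_lin _ _ _ _ _ _ _ _ jV1 (jet_cst 1 1)).
  by case=> // _; rewrite /=; ring.
have lam1 : flat 1 (fun t => h * t + k / 2 * t ^+ 2).
  apply: (jet_flat 1 _).
  have jt := jet_id 1 : jet 1 (fun t : R => t) [:: 0; 1].
  have j2 := jetM 1 _ _ _ _ [::] jt jt.
  have {}j2 := j2 ltac:(by case=> // _; rewrite big_ord_recl big_ord0 /=; ring).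
  apply: (jetT _ (fun t => h * t + k / 2 * (t * t))); last by move=> t; ring.
  by apply: (jet_lin _ _ _ _ _ _ _ _ jt j2); case=> // _; rewrite /=; ring.
apply/eqaddOP; rewrite kE.
(* Dividing the lower error by [P >= 1] does not enlarge it, and dividing the upper one by
   [V t * D ^+ 2 >= 1/2] at most doubles it; hence [M1 + 2 * M2]. *)
apply: filterS (nbhs_pinfty_ge (num_real (M1 + 2 * M2))) => K KM.
have key : \forall t \near 0^',
    `|fine (heis_dist (zeta 0) (zeta t)) ^+ 2 -
      (t ^+ 2 - k ^+ 2 / 720 * t ^+ 6)| <= K * `|t ^+ 7|.
  near=> t.
  have t0 : t != 0 by near: t; exact: nbhs_dnbhs_neq.
  have Vt : `|V t - 1| <= 2^-1.
    by near: t; apply: flat1_small => //; rewrite invr_gt0.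
  have lt1 : `|h * t + k / 2 * t ^+ 2| <= 1 by near: t; exact: flat1_small.
  have Vhalf : 2^-1 <= V t by move: Vt; rewrite ler_norml => /andP[? ?]; lra.
  have P1 : 1 <= 4 * phase (h * t + k / 2 * t ^+ 2) 2^-1.
    by have := phase_ge (h * t + k / 2 * t ^+ 2); lra.
  have low : `|2 * (4 * phase (h * t + k / 2 * t ^+ 2) 2^-1) * (h + k / 2 * t)
      * (t ^+ 2 * W t)
    + V t * (1 - (4 * phase (h * t + k / 2 * t ^+ 2) 2^-1
      * (h * t + k / 2 * t ^+ 2)) ^+ 2 / 16)
    - 4 * phase (h * t + k / 2 * t ^+ 2) 2^-1 * (1 - k ^+ 2 / 720 * t ^+ 4)|
      <= M1 * `|t| ^+ 5 by near: t; exact: lowM.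
  have up : `|(V t * (1 + h ^+ 2 * t ^+ 2 / 60)) ^+ 2 * (1 + h ^+ 4 * t ^+ 4 / 720)
    + 12 * t ^+ 2 * W t ^+ 2
    - V t * (1 + h ^+ 2 * t ^+ 2 / 60) ^+ 2 * (1 - k ^+ 2 / 720 * t ^+ 4)|
      <= M2 * `|t| ^+ 5 by near: t; exact: upM.
  have cV : c t = t ^+ 2 * V t by rewrite /V; field.
  have zW : zz t = t ^+ 3 * W t by rewrite /W; field.
  have V0 : 0 < V t by apply: lt_le_trans Vhalf; rewrite invr_gt0.
  have c0 : 0 < c t by rewrite cV mulr_gt0// exprn_even_gt0.
  (* This is the parameter [n] of the polynomial curve: a circle arc turning by the angle [h t] has
     first velocity component [cos (h t s)], whose quadratic term is [- h^2 t^2 s^2 / 2]. *)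
  have n0 : 0 <= h ^+ 2 * t ^+ 2 / 2 by rewrite divr_ge0// mulr_ge0// sqr_ge0.
  have /andP[dl du] := heis_dist_sqr_bounds (zeta 0) (zeta t) _ _ (qx t) (qy t)
    (zz t) (c t) _ erefl erefl erefl erefl erefl c0 lt1 n0.
  move: low up dl du; rewrite cV zW.
  move: (4 * phase _ _) P1 => P P1.
  set G := (X in `|X| <= M1 * _ -> _); set H := (X in _ -> `|X| <= M2 * _ -> _).
  move=> low up dl du.
  have P0 : 0 < P by apply: lt_le_trans P1.
  pose D := 1 + h ^+ 2 * t ^+ 2 / 60.
  have D1 : 1 <= D by rewrite lerDl divr_ge0// mulr_ge0// sqr_ge0.
  have D0 : 0 < D by apply: lt_le_trans D1.
  have dlE : 2 * (h * t + k / 2 * t ^+ 2) * (t ^+ 3 * W t) + t ^+ 2 * V t *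
      (1 - (P * (h * t + k / 2 * t ^+ 2)) ^+ 2 / 16) / P =
      t ^+ 2 - k ^+ 2 / 720 * t ^+ 6 + t ^+ 2 * (G / P).
    by rewrite /G; field; rewrite gt_eqF.
  have duE : t ^+ 2 * V t * (1 + (h ^+ 2 * t ^+ 2 / 2) ^+ 2 / 180) +
      12 * (t ^+ 3 * W t) ^+ 2 /
        (t ^+ 2 * V t * (1 + h ^+ 2 * t ^+ 2 / 2 / 30) ^+ 2) =
      t ^+ 2 - k ^+ 2 / 720 * t ^+ 6 + t ^+ 2 * (H / (V t * D ^+ 2)).
    have -> : 1 + h ^+ 2 * t ^+ 2 / 2 / 30 = D by rewrite /D; field.
    have -> : (h ^+ 2 * t ^+ 2 / 2) ^+ 2 / 180 = h ^+ 4 * t ^+ 4 / 720 by field.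
    rewrite /H -/D; have D_neq0 : D != 0 by rewrite gt_eqF.
    have V_neq0 : V t != 0 by rewrite gt_eqF.
    by clearbody D V W; field; rewrite t0 V_neq0 D_neq0.
  rewrite dlE in dl; rewrite duE in du.
  have t2 : 0 <= t ^+ 2 by exact: sqr_ge0.
  have t7 (b : R) : b * `|t ^+ 7| = t ^+ 2 * (b * `|t| ^+ 5).
    by rewrite normrX -(real_normK (num_real t)); ring.
  have GP : - (M1 * `|t| ^+ 5) <= G / P.
    have : `|G / P| <= M1 * `|t| ^+ 5.
      rewrite normrM (gtr0_norm (_ : 0 < P^-1)) ?invr_gt0//.
      by rewrite ler_pdivrMr// (le_trans low)// ler_peMr// mulr_ge0// exprn_ge0.
    by rewrite ler_norml => /andP[].
  have HV : H / (V t * D ^+ 2) <= 2 * M2 * `|t| ^+ 5.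
    have VD0 : 0 < V t * D ^+ 2 by rewrite mulr_gt0// exprn_gt0.
    have VD : 2^-1 <= V t * D ^+ 2.
      by rewrite (le_trans Vhalf)// ler_peMr ?exprn_ege1// ltW.
    have Mt : 0 <= 2 * M2 * `|t| ^+ 5 by rewrite !mulr_ge0// exprn_ge0.
    rewrite ler_pdivrMr//; apply: le_trans (ler_norm _) _; apply: le_trans up _.
    apply: le_trans (ler_wpM2l Mt VD).
    by rewrite le_eqVlt; apply/orP; left; apply/eqP; field.
  have := ler_wpM2l t2 GP; have := ler_wpM2l t2 HV.
  rewrite mulrN -!t7 => h1 h2.
  have h3 : M1 * `|t ^+ 7| <= K * `|t ^+ 7|.
    by rewrite ler_wpM2r// (le_trans _ KM)// lerDl mulr_ge0.
  have h4 : 2 * M2 * `|t ^+ 7| <= K * `|t ^+ 7|.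
    by rewrite ler_wpM2r// (le_trans _ KM)// lerDr.
  rewrite ler_distl; apply/andP; split.
    by apply: le_trans dl; rewrite lerD2l (le_trans _ h2)// lerN2.
  by apply: le_trans du _; rewrite lerD2l (le_trans h1).
(* The estimate extends from the punctured neighbourhood to [t = 0], where both the distance and the
   polynomial vanish. *)
have {}key : \forall t \near (0 : R), t != 0 -> _ := key.
apply: filterS key => t; have [->|t0 /(_ isT)] := eqVneq t 0; last by [].
rewrite /= !fctE heis_dist_refl /= !expr0n /= mulr0 !subrr normr0 mulr_ge0//.
by rewrite (le_trans _ KM)// addr_ge0// mulr_ge0.
Unshelve. all: by end_near. Qed.
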